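(* Let $I,J\subset\mathbb{T}$ be nonempty finite subtrees. There is a canonical one-to-one correspondence between the space $\mathcal{K}(J)\backslash\mathrm{Hier}(\mathbb{T})/\mathcal{K}(I)$ of double cosets and the set of all $(I,J)$-bi-trees defined up to equivalence.
   Context: $\mathbb{T}$ is the tree (unique up to isomorphism) in which every vertex has countably infinite valence. A subtree $S\subset\mathbb{T}$ isomorphic to $\mathbb{T}$ is a $(\mathbb{T})$-subtree if only finitely many edges $[a,b]$ of $\mathbb{T}$ satisfy $a\in S$, $b\notin S$. A $(\mathbb{T})$-covering forest is a finite collection of pairwise disjoint $(\mathbb{T})$-subtrees obtained from $\mathbb{T}$ by removing a finite collection of edges (keeping all vertices). A spheromorphism $g$ is given by two $(\mathbb{T})$-covering forests $S_1,\dots,S_k$ and $R_1,\dots,R_k$ and tree isomorphisms $g^{(j)}:S_j\to R_j$; it is identified with the induced permutation of $\mathrm{vert}(\mathbb{T})$. $\mathrm{Hier}(\mathbb{T})\supset\mathrm{Aut}(\mathbb{T})$ is the group of all spheromorphisms. $\mathcal{K}(J)\subset\mathrm{Aut}(\mathbb{T})$ is the pointwise stabilizer of a finite subtree $J$. Let $\Gamma$ be a finite graph whose edges are colored black, blue, and red, equipped with embeddings $\imath:I\to\Gamma$, $\jmath:J\to\Gamma$. Denote by $\Gamma^{black}_{blue}$ the subgraph consisting of black and blue edges, by $\Gamma^{black}_{red}$ the subgraph consisting of black and red edges. $(\Gamma,\imath,\jmath)$ is an $(I,J)$-bi-tree if: the subgraphs $\Gamma^{black}_{blue}$ and $\Gamma^{black}_{red}$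 are trees; $\imath(I)\subset\Gamma^{black}_{blue}$, $\jmath(J)\subset\Gamma^{black}_{red}$; any vertex of $\Gamma$ of valence 1 is an end of a black edge contained in $\imath(I)$ or $\jmath(J)$. Two $(I,J)$-bi-trees $(\Gamma,\imath,\jmath)$ and $(\Gamma',\imath',\jmath')$ are equivalent if there is a color-preserving isomorphism $\lambda:\Gamma\to\Gamma'$ such that $\imath'=\lambda\circ\imath$, $\jmath'=\lambda\circ\jmath$. For orientation, the word ''canonical'' refers to the following construction of a bi-tree from $g\in\mathrm{Hier}(\mathbb{T})$. A $(\mathbb{T})$-covering forest is compatible with $g$ if $g$ restricted to each of its trees is an embedding of trees; the perfect forest $\{S_\alpha\}$ of $g$ is the unique compatible one from which every compatible $(\mathbb{T})$-covering forest is obtained by removing finitely many edges. Paint blue the edges of $\mathbb{T}$ not in $\bigcup S_\alpha$ and red the edges of $\mathbb{T}$ not in $\bigcup gS_\alpha$. Let $\mathrm{Skel}_I$ be the minimal subtree containing $I$ and all blue edges, $\mathrm{Skel}_J$ the minimal subtree containing $J$ and all red edges, and $\Xi_k\subset S_k$ the minimal subtree containing $S_k\cap\mathrm{Skel}_I$ and $g^{-1}(gS_k\cap\mathrm{Skel}_J)$. Take the disjoint union of the $\Xi_k$ (all edges black), add a blue edge joining $a,b$ for each blue edge $[a,b]$ and a red edge joining $g^{-1}a,g^{-1}b$ for each red edge $[a,b]$; $\imath$ is the inclusion and $\jmath=g^{-1}|_J$.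
   Formalization: In the definition of a bi-tree, a vertex of valence 1 must be an end of a black edge and itself lie in ι(I) or ȷ(J), rather than the edge lying there; this agrees if I and J both have edges, and the edge version fails for one-vertex I or J (e.g. I={v}, J={w}, v≠w, g=id). *)

(* Defs.v *)
From HB Require Import structures.
From mathcomp Require Import all_boot.
From mathcomp Require Import boolp classical_sets functions cardinality.

Set Implicit Arguments.
Unset Strict Implicit.
Unset Printing Implicit Defensive.

Local Open Scope classical_set_scope.

(* A simple graph is a symmetric irreflexive relation on its vertices. *)

Definition joined (W : eqType) (e : rel W) (x y : W) : Prop :=
  exists2 p, path e x p & last x p = y.

Definition tree (W : eqType) (e : rel W) : Prop :=
  [/\ symmetric e, irreflexive e,
      exists x : W, True,
      forall x y, joined e x y &
      forall c : seq W, cycle e c -> uniq c -> size c <= 2].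

Section Trees.
Variables (V : choiceType) (adj : rel V).
Implicit Types (S R A I J : set V) (F : set (set V)) (E : set (V * V)).
Implicit Types (f g k : V -> V).

(* The tree T, on the vertex set V. *)
Definition regular_tree : Prop :=
  tree adj /\ forall x, ([set y | adj x y] #= [set: nat])%card.

(* A subtree of a tree is the full subgraph on its vertices, so it is
   represented by its set of vertices. *)
Definition restrict_rel S : rel V :=
  [rel x y | [&& adj x y, x \in S & y \in S]].

Definition subtree S : Prop :=
  S !=set0 /\ forall x y, S x -> S y -> joined (restrict_rel S) x y.

Definition hull A : set V := smallest subtree A.

Definition tree_iso S R f : Prop :=
  set_bij S R f /\ {in S &, forall x y, adj (f x) (f y) = adj x y}.

Definition tree_embedding S f : Prop :=
  set_inj S f /\ {in S &, forall x y, adj x y -> adj (f x) (f y)}.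

Definition T_subtree S : Prop :=
  [/\ subtree S, exists f, tree_iso [set: V] S f &
      finite_set [set e : V * V | [/\ adj e.1 e.2, S e.1 & ~ S e.2]]].

(* The connected components of the graph e once the edges in E are removed;
   (x, y) in E stands for the unoriented edge [x, y]. *)
Definition components_without (e : rel V) E : set (set V) :=
  range (fun x => [set y | joined
    [rel a b | [&& e a b, (a, b) \notin E & (b, a) \notin E]] x y]).

Definition covering_forest F : Prop :=
  [/\ finite_set F, trivIset F id, F `<=` T_subtree &
      exists2 E, finite_set E & F = components_without adj E].

Definition same_tree F (x y : V) : Prop := exists2 S, F S & S x /\ S y.

Definition forest_rel F : rel V := [rel x y | adj x y && `[< same_tree F x y >]].

(* Membership in Hier(T). *)
Definition spheromorphism g : Prop :=
  exists n (S R : 'I_n -> set V),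
    [/\ injective S, injective R, covering_forest (range S),
        covering_forest (range R) & forall j, tree_iso (S j) (R j) g].

(* Pointwise stabilizer of J in Aut(T). *)
Definition stabilizer J : set (V -> V) :=
  [set k | tree_iso [set: V] [set: V] k /\ forall x, J x -> k x = x].

Definition double_coset I J g : set (V -> V) :=
  [set h | exists kJ kI,
     [/\ stabilizer J kJ, stabilizer I kI & h = kJ \o g \o kI]].

Definition double_cosets I J : set (set (V -> V)) :=
  double_coset I J @` spheromorphism.

Definition compatible g F : Prop :=
  covering_forest F /\ forall S, F S -> tree_embedding S g.

Definition perfect_forest g F : Prop :=
  compatible g F /\
  forall F', compatible g F' ->
    exists2 E, finite_set E & F' = components_without (forest_rel F) E.

End Trees.

Inductive color := Black | Blue | Red.

(* Each edge of the simple graph carries exactly one color; col x y = None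
   means that x and y are not adjacent. *)
Structure colored_graph := ColoredGraph {
  vert :> finType;
  col : vert -> vert -> option color;
  col_sym : forall x y, col x y = col y x;
  col_irr : forall x, col x x = None
}.

(* Both subgraphs keep all the vertices. *)
Definition black_blue (G : colored_graph) : rel G :=
  [rel x y | if col x y is Some (Black | Blue) then true else false].

Definition black_red (G : colored_graph) : rel G :=
  [rel x y | if col x y is Some (Black | Red) then true else false].

Definition valence (G : colored_graph) (x : G) : nat :=
  #|[pred y : G | isSome (col x y)]|.

Section BiTrees.
Variables (V : choiceType) (adj : rel V) (I J : set V).

(* In the last axiom it is the vertex x that is required to lie in the image of
   I or J: when I and J both have an edge, this amounts to requiring it of the
   black edge at x, but I and J may be single vertices. The embeddings are
   those of subgraphs: vertices of I that are not adjacent may have adjacent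
   images (joined by a red edge). *)
Record bitree := BiTree {
  graph :> colored_graph;
  imap : I -> graph;
  jmap : J -> graph;
  imap_inj : injective imap;
  jmap_inj : injective jmap;
  imap_edge : forall x y : I,
    adj (val x) (val y) -> black_blue (imap x) (imap y);
  jmap_edge : forall x y : J,
    adj (val x) (val y) -> black_red (jmap x) (jmap y);
  black_blue_tree : tree (@black_blue graph);
  black_red_tree : tree (@black_red graph);
  bitree_leaf : forall x : graph, valence x = 1 ->
    (exists y, col x y = Some Black) /\ (range imap x \/ range jmap x)
}.

Definition bitree_equiv (B B' : bitree) : Prop :=
  exists lambda : B -> B',
    [/\ bijective lambda,
        forall x y, col (lambda x) (lambda y) = col x y,
        forall x, imap B' x = lambda (imap B x) &
        forall x, jmap B' x = lambda (jmap B x)].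

(* A predicate rather than a term of type set: a bitree carries a finType and
   so lives in a universe above the one of the sets of classical_sets. *)
Definition bitree_class (C : bitree -> Prop) : Prop :=
  exists B, C = bitree_equiv B.

Section Canonical.
Variables (g : V -> V) (F : set (set V)).

Definition blue_edge (x y : V) : Prop := adj x y /\ ~ same_tree F x y.

Definition red_edge (x y : V) : Prop :=
  adj x y /\ ~ same_tree [set g @` S | S in F] x y.

Definition skel_I : set V :=
  hull adj (I `|` [set x | exists y, blue_edge x y]).

Definition skel_J : set V :=
  hull adj (J `|` [set x | exists y, red_edge x y]).

Definition Xi (S : set V) : set V :=
  hull adj ((S `&` skel_I) `|` g @^-1` (g @` S `&` skel_J)).

(* The trees of F being disjoint, the disjoint union of the Xi S is realized
   on a set of vertices of T. *)
Definition canonical_vert : set V := \bigcup_(S in F) Xi S.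

Definition canonical_edge (c : color) (x y : V) : Prop :=
  match c with
  | Black => adj x y /\ exists2 S, F S & Xi S x /\ Xi S y
  | Blue => blue_edge x y
  | Red => red_edge (g x) (g y)
  end.

End Canonical.

(* B is, up to equivalence, the bi-tree constructed from g; phi identifies its
   vertices with those of the construction. *)
Definition canonical_bitree (g : V -> V) (B : bitree) : Prop :=
  exists2 F, perfect_forest adj g F &
  exists phi : B -> V,
    [/\ set_bij [set: B] (canonical_vert g F) phi,
        forall c x y,
          col x y = Some c <-> canonical_edge g F c (phi x) (phi y),
        forall x : I, phi (imap B x) = val x &
        forall y : J, g (phi (jmap B y)) = val y].

End BiTrees.

(* Main.v *)
Require Import Defs.
From mathcomp Require Import all_boot.
From mathcomp Require Import boolp classical_sets functions cardinality.
Set Implicit Arguments.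
Unset Strict Implicit.
Unset Printing Implicit Defensive.
Local Open Scope classical_set_scope.

(* A spheromorphism g is a bijection of the vertices such that T and its
   pullback under g differ by finitely many edges: the blue ones are edges of T
   only, the red ones of the pullback only, the black ones of both, and the
   trees of the perfect forest are the components of the black graph. The
   canonical bi-tree is the smallest finite set of vertices which contains I,
   g^-1 J and the ends of blue and red edges and is connected in both trees; the
   axiom on leaves expresses this minimality. Conversely, all valences being
   infinite, isomorphisms between finite subtrees extend by back and forth.
   Hence a bi-tree can be embedded twice in T, and the second embedding composed
   with the inverse of the first extends, one black component at a time, to a
   spheromorphism; if g and g' have the same bi-tree, the identification of the
   two copies of it extends to an automorphism k fixing I, and g' k^-1 g^-1 is
   an automorphism fixing J. *)

(** * Paths in forests *)

(** Hulls and perfect forests are awkward to transport along automorphisms. The canonical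
    construction is therefore replaced by the relation [presents]: an embedding of the bi-tree in T
    whose image contains the ends of all altered edges and on which adjacency, before and after [g],
    is read from the colors. Existence takes an admissible vertex set of minimal size, whose leaves
    must come from I or g^-1 J; conversely the leaf axiom forces the image of any presentation to be
    the canonical vertex set. Connectedness in the second tree comes for free: a set connected in
    one tree and containing the ends of all edges proper to the other is connected in the other.
    Back and forth is stated for forests, since a spheromorphism is an isomorphism only between
    black components; one run treats all of them together. *)

Section Joined.
Variables (W : eqType) (e : rel W).

Lemma joined_refl x : joined e x x.
Proof. by exists [::]. Qed.

Lemma joined_trans y x z : joined e x y -> joined e y z -> joined e x z.
Proof.
move=> [p ep <-] [q eq <-]; exists (p ++ q); last exact: last_cat.
by rewrite cat_path ep.
Qed.

Lemma joined_edge x y : e x y -> joined e x y.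
Proof. by move=> exy; exists [:: y]; rewrite //= exy. Qed.

Lemma joined_ind (Q : W -> Prop) x y :
  Q x -> (forall a b, e a b -> Q a -> Q b) -> joined e x y -> Q y.
Proof.
move=> Qx Qe [p + <-]; elim: p x Qx => //= a p IHp x Qx /andP[exa].
exact/IHp/(Qe x).
Qed.

Lemma joined_sym x y : symmetric e -> joined e x y -> joined e y x.
Proof.
move=> es; apply: (joined_ind (Q := joined e ^~ x)) => [|a b eab].
  exact: joined_refl.
by move=> ax; apply: joined_trans ax; apply: joined_edge; rewrite es.
Qed.

Lemma joined_uniq x y : joined e x y ->
  exists p, [/\ path e x p, uniq (x :: p) & last x p = y].
Proof. by case=> p /shortenP[q eq uq _] <-; exists q. Qed.

Lemma joined_path x p y : path e x p -> y \in x :: p -> joined e x y.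
Proof.
rewrite inE => ep /predU1P[->|]; first exact: joined_refl.
move=> yp; case: _ / (path.splitP yp) ep => p1 p2.
by rewrite cat_path => /andP[ep1 _]; exists (rcons p1 y); rewrite ?last_rcons.
Qed.

Lemma joined_exit (S : set W) x y : S x -> ~ S y -> joined e x y ->
  exists a b, [/\ e a b, S a & ~ S b].
Proof.
move=> Sx nSy xy; apply: contrapT => none; apply: nSy; move: xy.
apply: (joined_ind (Q := S)) => // a b eab Sa; apply: contrapT => nSb.
by apply: none; exists a, b.
Qed.

End Joined.

Lemma joined_map (W W' : eqType) (e : rel W) (e' : rel W') (h : W -> W') x y :
  (forall a b, e a b -> e' (h a) (h b)) ->
  joined e x y -> joined e' (h x) (h y).
Proof.
move=> ee'; apply: (joined_ind (Q := fun z => joined e' (h x) (h z))).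
  exact: joined_refl.
by move=> a b /ee' eab xa; apply: joined_trans xa _; apply: joined_edge.
Qed.

Lemma joined_sub (W : eqType) (e e' : rel W) x y :
  subrel e e' -> joined e x y -> joined e' x y.
Proof. by move=> ee'; apply: (joined_map (h := id)). Qed.

Definition acyclic (W : eqType) (e : rel W) : Prop :=
  forall c : seq W, cycle e c -> uniq c -> size c <= 2.

Lemma acyclic_sub (W : eqType) (e e' : rel W) :
  subrel e e' -> acyclic e' -> acyclic e.
Proof. by move=> ee' ac [|x c] //= ec; apply: (ac (x :: c)); apply: sub_path ec. Qed.

Lemma acyclic_preim (W W' : eqType) (e : rel W) (h : W' -> W) :
  injective h -> acyclic e -> acyclic (relpre h e).
Proof.
move=> hI ac [|x c] // ec uc; rewrite -(size_map h); apply: (ac (map h (x :: c))).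
  by rewrite cycle_map.
by rewrite map_inj_uniq.
Qed.

Section Restrict.
Variables (W : choiceType).
Implicit Types (e : rel W) (S M : set W).

Lemma restrict_relP e S x y :
  reflect [/\ e x y, S x & S y] (restrict_rel e S x y).
Proof.
apply: (iffP and3P) => -[exy]; first by rewrite !inE.
by move=> Sx Sy; rewrite !inE.
Qed.

Lemma restrict_sym e S : symmetric e -> symmetric (restrict_rel e S).
Proof. by move=> es x y; rewrite /restrict_rel /= es [(x \in S) && _]andbC. Qed.

Lemma restrict_irr e S : irreflexive e -> irreflexive (restrict_rel e S).
Proof. by move=> ei x; rewrite /restrict_rel /= ei. Qed.

Lemma restrict_sub e S : subrel (restrict_rel e S) e.
Proof. by move=> x y /and3P[]. Qed.

Lemma restrict_subset e S M x y :
  S `<=` M -> restrict_rel e S x y -> restrict_rel e M x y.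
Proof. by move=> SM /restrict_relP[exy /SM Sx /SM Sy]; apply/restrict_relP. Qed.

Lemma restrict_path e S x p : S x ->
  path (restrict_rel e S) x p -> forall y, y \in x :: p -> S y.
Proof.
move=> Sx ep y /(joined_path ep).
by apply: (joined_ind (Q := S)) => // a b /restrict_relP[].
Qed.

Lemma path_restrict e S x p :
  path e x p -> (forall y, y \in x :: p -> S y) -> path (restrict_rel e S) x p.
Proof.
elim: p x => //= a p IHp x /andP[xa ep] Sp; apply/andP; split.
  by apply/restrict_relP; split=> //; apply: Sp; rewrite !inE eqxx ?orbT.
by apply: IHp => // y yp; apply: Sp; rewrite inE yp orbT.
Qed.

Lemma joined_restrict_end e S x y : S x -> joined (restrict_rel e S) x y -> S y.
Proof. by move=> Sx; apply: (joined_ind (Q := S)) => // a b /restrict_relP[]. Qed.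

End Restrict.

Section Forest.
Variables (W : choiceType) (e : rel W).
Hypotheses (es : symmetric e) (ac : acyclic e).

(** If [a] and [a'] differed, a simple path from one to the other inside [S], closed up through [x],
    would be a cycle of length at least 3. This is the working form of acyclicity. *)
Lemma unique_gate S x a a' : ~ S x -> joined (restrict_rel e S) a a' ->
  e x a -> e x a' -> a = a'.
Proof.
move=> nSx aa' xa xa'; case: (eqVneq a a') => // naa'.
have [p [ep up pa']] := joined_uniq aa'.
have Sa : S a.
  by case: p ep pa' {up} naa' => [|b p] /=; [move=> _ ->; rewrite eqxx|
    case/andP => /restrict_relP[]].
have Sp := restrict_path Sa ep.
case: p ep up pa' Sp => [|b p].
  by move=> _ _ /= aa; rewrite aa eqxx in naa'.
move=> ep up pa' Sp; suff : size [:: x, a, b & p] <= 2 by [].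
apply: (ac (c := [:: x, a, b & p])).
  have -> : cycle e [:: x, a, b & p] = e x a && path e a (rcons (b :: p) x) by [].
  rewrite xa rcons_path pa' es xa' andbT.
  exact: sub_path (@restrict_sub _ e S) _ _ ep.
rewrite cons_uniq up andbT; apply/negP => /Sp; exact: nSx.
Qed.

Lemma unique_path x p q : path e x p -> path e x q ->
  uniq (x :: p) -> uniq (x :: q) -> last x p = last x q -> p = q.
Proof.
elim: p x q => [|a p IHp] x [|b q] //.
- by move=> _ _ _ /andP[+ _] /= xq; rewrite xq mem_last.
- by move=> _ _ /andP[+ _] _ /= xp; rewrite -xp mem_last.
move=> /= /andP[xa pa] /andP[xb qb] /andP[xp up] /andP[xq uq] pq.
suff ab : a = b by rewrite ab in pa up pq *; congr cons; apply: (IHp b).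
(* The tails of both paths avoid [x] and share their end, so [a] and [b] are neighbours of [x]
   joined off [x]. *)
apply: (@unique_gate [set~ x] x) => //; first by apply.
have toend c r : path e c r -> x \notin c :: r ->
    joined (restrict_rel e [set~ x]) c (last c r).
  move=> er xr; exists r => //; apply: path_restrict => // y yr /= yx.
  by rewrite -yx yr in xr.
apply: joined_trans (toend _ _ pa xp) _; rewrite pq.
by apply: joined_sym; [apply: restrict_sym | apply: toend].
Qed.

(** A path inside [S] and an [e0]-path with the same ends reduce to the same simple path, which then
    has both properties. *)
Lemma subtree_convex e0 S x y : subrel e0 e ->
  joined (restrict_rel e S) x y -> joined e0 x y -> S x ->
  joined (restrict_rel e0 S) x y.
Proof.
move=> e0e /joined_uniq[p [ep up py]] /joined_uniq[q [eq uq qy]] Sx.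
have pq : p = q.
  apply: (@unique_path x) => //; last by rewrite py qy.
    exact: sub_path (@restrict_sub _ e S) _ _ ep.
  exact: sub_path e0e _ _ eq.
exists q => //; apply: path_restrict => //; rewrite -pq.
exact: restrict_path ep.
Qed.

(** The edge [[x, y]] is the only simple path from [x] to [y], so an [e0]-path between them reduces
    to it. *)
Lemma joined_adjacent e0 x y : subrel e0 e -> irreflexive e ->
  joined e0 x y -> e x y -> e0 x y.
Proof.
move=> e0e ei /joined_uniq[p [ep up py]] xy.
suff -> : y = head x p.
  by case: p ep py {up} => [_ /= xx|a p /andP[]//]; rewrite -xx ei in xy.
have xney : x != y by apply/eqP => xx; rewrite xx ei in xy.
have -> : p = [:: y] => //.
apply: (@unique_path x) => //=; first exact: sub_path e0e _ _ ep.
  by rewrite xy.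
by rewrite inE xney.
Qed.

End Forest.

(** * Partial isomorphisms and back and forth *)

Section PartialIso.
Variables (V1 V2 : choiceType) (e1 : rel V1) (e2 : rel V2).
Implicit Types P Q : seq (V1 * V2).

Definition pair_rel P : rel (V1 * V2) :=
  [rel p q | [&& e1 p.1 q.1, p \in P & q \in P]].

(* The domain and the range of P are connected inside each component of e1,
   resp. e2, that they meet: this is what keeps a vertex outside P from having
   two neighbours in it, so that P can be extended one vertex at a time. *)
Definition partial_iso P : Prop :=
  [/\ {in P &, forall p q, (p.1 == q.1) = (p.2 == q.2)},
      {in P &, forall p q, e1 p.1 q.1 = e2 p.2 q.2},
      {in P &, forall p q, joined e1 p.1 q.1 -> joined (pair_rel P) p q} &
      {in P &, forall p q, joined e2 p.2 q.2 -> joined (pair_rel P) p q}].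

(** The last clause keeps [Q] inside the components that [P] meets, so that infinite valence need
    only be assumed there. *)
Definition extends P Q : Prop :=
  [/\ {subset P <= Q}, partial_iso Q &
      forall q, q \in Q ->
        exists2 p, p \in P & joined e1 p.1 q.1 /\ joined e2 p.2 q.2].

Lemma pair_rel_sub P Q : {subset P <= Q} -> subrel (pair_rel P) (pair_rel Q).
Proof. by move=> PQ p q /and3P[pq /PQ pQ /PQ qQ]; apply/and3P. Qed.

Lemma pair_rel1 P p q : joined (pair_rel P) p q -> p \in P ->
  joined (restrict_rel e1 [set x | x \in map fst P]) p.1 q.1.
Proof.
move=> pq pP; apply: (joined_map (h := fst)) pq => a b /and3P[ab aP bP].
by apply/restrict_relP; split=> //=; apply: map_f.
Qed.

Lemma pair_rel2 P p q : partial_iso P -> joined (pair_rel P) p q -> p \in P ->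
  joined (restrict_rel e2 [set x | x \in map snd P]) p.2 q.2.
Proof.
case=> _ e12 _ _ pq pP; apply: (joined_map (h := snd)) pq => a b.
case/and3P=> [ab aP bP].
by apply/restrict_relP; split=> /=; [rewrite -e12 | apply: map_f | apply: map_f].
Qed.

End PartialIso.

Section PartialIsoStep.
Variables (V1 V2 : choiceType) (e1 : rel V1) (e2 : rel V2).
Hypotheses (s1 : symmetric e1) (i1 : irreflexive e1) (ac1 : acyclic e1).
Hypotheses (s2 : symmetric e2) (i2 : irreflexive e2) (ac2 : acyclic e2).
Implicit Types P Q : seq (V1 * V2).

(** The image of [x] is any neighbour of [a.2] outside the finite range of [P]. As [P] is linked
    inside components, [a] is the only pair of [P] that can be adjacent to [x] on the first side or
    to [y] on the second, so no other adjacency has to be matched. *)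
Lemma partial_iso_step P a x : partial_iso e1 e2 P -> a \in P -> e1 a.1 x ->
  x \notin map fst P -> infinite_set [set y | e2 a.2 y] ->
  exists2 y, e2 a.2 y & partial_iso e1 e2 ((x, y) :: P).
Proof.
move=> PP aP ax xP inf; have [inj adj12 l1 l2] := PP.
have [y [ay /= yP]] := infinite_setN0 (infinite_setD inf (finite_seq (map snd P))).
exists y => //.
have gate1 q : q \in P -> e1 x q.1 -> a = q.
  move=> qP xq; apply/eqP; rewrite -pair_eqE /pair_eq -inj // andbb; apply/eqP.
  apply: (unique_gate s1 ac1 (S := [set x | x \in map fst P]) (x := x)) => //.
  - exact/negP.
  - apply: pair_rel1 => //; apply: l1 => //.
    by apply: joined_trans (joined_edge ax) (joined_edge xq).
  - by rewrite s1.
have gate2 q : q \in P -> e2 y q.2 -> a = q.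
  move=> qP yq; apply/eqP; rewrite -pair_eqE /pair_eq inj // andbb; apply/eqP.
  apply: (unique_gate s2 ac2 (S := [set x | x \in map snd P]) (x := y)) => //.
  - apply: (pair_rel2 PP) => //; apply: l2 => //.
    by apply: joined_trans (joined_edge ay) (joined_edge yq).
  - by rewrite s2.
have sub : subrel (pair_rel e1 P) (pair_rel e1 ((x, y) :: P)).
  by apply: pair_rel_sub => p pP; rewrite inE pP orbT.
have e12 q : q \in P -> e1 x q.1 = e2 y q.2.
  move=> qP; apply/idP/idP => [/(gate1 _ qP)|/(gate2 _ qP)] <-.
    by rewrite s2.
  by rewrite s1.
have ax' : joined (pair_rel e1 ((x, y) :: P)) a (x, y).
  by apply: joined_edge; rewrite /pair_rel /= ax !inE eqxx aP orbT.
have xa' : joined (pair_rel e1 ((x, y) :: P)) (x, y) a.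
  by apply: joined_edge; rewrite /pair_rel /= s1 ax !inE eqxx aP orbT.
split=> p q; rewrite !inE => /predU1P[->|pP] /predU1P[->|qP] /=.
- by rewrite !eqxx.
- have /negPf-> : x != q.1.
    by apply: contraNneq xP => ->; apply: map_f.
  by apply/esym/negbTE; apply/eqP => yq; apply: yP; rewrite yq map_f.
- have /negPf-> : p.1 != x.
    by apply: contraNneq xP => <-; apply: map_f.
  by apply/esym/negbTE; apply/eqP => yq; apply: yP; rewrite -yq map_f.
- exact: inj.
- by rewrite i1 i2.
- exact: e12.
- by rewrite s1 s2 e12.
- exact: adj12.
- by move=> _; apply: joined_refl.
- move=> xq; apply: joined_trans xa' _; apply: joined_sub sub _.
  by apply: l1 => //; apply: joined_trans (joined_edge ax) xq.
- move=> px; apply: joined_trans _ ax'; apply: joined_sub sub _.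
  by apply: l1 => //; apply: joined_trans px (joined_edge _); rewrite s1.
- by move=> pq; apply: joined_sub sub _; apply: l1.
- by move=> _; apply: joined_refl.
- move=> xq; apply: joined_trans xa' _; apply: joined_sub sub _.
  by apply: l2 => //; apply: joined_trans (joined_edge ay) xq.
- move=> px; apply: joined_trans _ ax'; apply: joined_sub sub _.
  by apply: l2 => //; apply: joined_trans px (joined_edge _); rewrite s2.
- by move=> pq; apply: joined_sub sub _; apply: l2.
Qed.

Lemma extends_step P Q p x :
  (forall p y, p \in P -> joined e2 p.2 y -> infinite_set [set z | e2 y z]) ->
  extends e1 e2 P Q -> p \in P -> joined e1 p.1 x ->
  exists Q', [/\ extends e1 e2 P Q', {subset Q <= Q'} & x \in map fst Q'].
Proof.
move=> inf PQ pP.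
apply: (joined_ind (Q := fun x => exists Q',
  [/\ extends e1 e2 P Q', {subset Q <= Q'} & x \in map fst Q'])).
  by exists Q; split=> //; apply: map_f; case: PQ => PQ _ _; apply: PQ.
move=> {}x z xz [Q' [[PQ' isoQ' reach] QQ' /mapP[a aQ' ax]]].
case: (boolP (z \in map fst Q')) => [zQ'|nzQ']; first by exists Q'.
have [q qP [qa1 qa2]] := reach _ aQ'; rewrite ax in xz.
have [y ay isoQ''] := partial_iso_step isoQ' aQ' xz nzQ' (inf _ _ qP qa2).
have sub : {subset Q' <= (z, y) :: Q'}.
  by move=> b bQ'; rewrite inE bQ' orbT.
exists ((z, y) :: Q'); split.
- split=> // [b /PQ'/sub|b]//; rewrite inE => /predU1P[->|]; last exact: reach.
  exists q => //; split.
    exact: joined_trans qa1 (joined_edge xz).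
  exact: joined_trans qa2 (joined_edge ay).
- by move=> b /QQ'/sub.
- by rewrite inE eqxx.
Qed.

Lemma extends_seq P (s : seq V1) : partial_iso e1 e2 P ->
  (forall p y, p \in P -> joined e2 p.2 y -> infinite_set [set z | e2 y z]) ->
  {in s, forall x, exists2 p, p \in P & joined e1 p.1 x} ->
  exists2 Q, extends e1 e2 P Q & {subset s <= map fst Q}.
Proof.
move=> isoP inf; elim: s => [_|x s IHs reach].
  exists P => //; split=> // p pP.
  by exists p => //; split; apply: joined_refl.
have [y ys|Q PQ sQ] := IHs; first by apply: reach; rewrite inE ys orbT.
have [p pP px] := reach _ (mem_head _ _).
have [Q' [PQ' QQ' xQ']] := extends_step inf PQ pP px.
exists Q' => // y; rewrite inE => /predU1P[->//|/sQ/mapP[q qQ ->]].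
by apply: map_f; apply: QQ'.
Qed.

End PartialIsoStep.

Section Swap.
Variables (V1 V2 : choiceType).
Implicit Types (P Q : seq (V1 * V2)).

Definition swap (T1 T2 : Type) (p : T1 * T2) := (p.2, p.1).

Lemma swapK (T1 T2 : Type) : cancel (@swap T1 T2) (@swap T2 T1).
Proof. by case. Qed.

Lemma mem_swap P p : (swap p \in map (@swap V1 V2) P) = (p \in P).
Proof. exact: mem_map (can_inj (@swapK _ _)) _ _. Qed.

Lemma map_swapK P : map (@swap V2 V1) (map (@swap V1 V2) P) = P.
Proof. by rewrite mapK //; apply: swapK. Qed.

Lemma partial_iso_swap (e1 : rel V1) (e2 : rel V2) P :
  partial_iso e1 e2 P -> partial_iso e2 e1 (map (@swap V1 V2) P).
Proof.
case=> inj adj l1 l2.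
have link p q : joined (pair_rel e1 P) p q ->
    joined (pair_rel e2 (map (@swap V1 V2) P)) (swap p) (swap q).
  apply: joined_map => a b /and3P[ab aP bP].
  by rewrite /pair_rel /= !mem_swap aP bP -adj ?ab.
split=> _ _ /mapP[p pP ->] /mapP[q qP ->] /=.
- by rewrite inj.
- by rewrite adj.
- by move/(l2 _ _ pP qP)/link.
- by move/(l1 _ _ pP qP)/link.
Qed.

Lemma extends_swap (e1 : rel V1) (e2 : rel V2) P Q :
  extends e1 e2 P Q ->
  extends e2 e1 (map (@swap V1 V2) P) (map (@swap V1 V2) Q).
Proof.
case=> PQ isoQ reach; split; last 1 first.
- move=> _ /mapP[q qQ ->]; have [p pP []] := reach _ qQ.
  by exists (swap p); rewrite ?mem_swap.
- by move=> _ /mapP[p pP ->]; rewrite mem_swap; apply: PQ.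
- exact: partial_iso_swap.
Qed.

End Swap.

Section BackAndForth.
Variables (V1 V2 : choiceType) (e1 : rel V1) (e2 : rel V2).
Hypotheses (s1 : symmetric e1) (i1 : irreflexive e1) (ac1 : acyclic e1).
Hypotheses (s2 : symmetric e2) (i2 : irreflexive e2) (ac2 : acyclic e2).
Hypotheses (c1 : countable [set: V1]) (c2 : countable [set: V2]).
Variable P : seq (V1 * V2).

Let D1 : set V1 := [set x | exists2 p, p \in P & joined e1 p.1 x].
Let D2 : set V2 := [set y | exists2 p, p \in P & joined e2 p.2 y].

Hypotheses (isoP : partial_iso e1 e2 P) (P0 : P != [::]).
Hypothesis inf1 : forall x, D1 x -> infinite_set [set z | e1 x z].
Hypothesis inf2 : forall y, D2 y -> infinite_set [set z | e2 y z].

Lemma back_and_forth_step Q x y : extends e1 e2 P Q ->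
  exists Q', [/\ extends e1 e2 P Q', {subset Q <= Q'},
    D1 x -> x \in map fst Q' & D2 y -> y \in map snd Q'].
Proof.
move=> PQ.
have [Q' [PQ' QQ' xQ']] : exists Q', [/\ extends e1 e2 P Q', {subset Q <= Q'} &
    D1 x -> x \in map fst Q'].
  case: (pselect (D1 x)) => [[p pP px]|nx]; last by exists Q; split.
  have inf q z : q \in P -> joined e2 q.2 z -> infinite_set [set t | e2 z t].
    by move=> qP qz; apply: inf2; exists q.
  have [Q' [PQ' QQ' xQ']] := extends_step s1 i1 ac1 s2 i2 ac2 inf PQ pP px.
  by exists Q'; split.
case: (pselect (D2 y)) => [[p pP py]|ny]; last by exists Q'; split.
pose sw := map (@swap V1 V2).
have inf q z : q \in sw P -> joined e1 q.2 z -> infinite_set [set t | e1 z t].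
  by case/mapP=> {}q qP -> qz; apply: inf1; exists q.
have spP : swap p \in sw P by rewrite mem_swap.
have [Q2 [PQ2 QQ2 yQ2]] :=
  extends_step s2 i2 ac2 s1 i1 ac1 inf (extends_swap PQ') spP py.
pose Q3 := map (@swap V2 V1) Q2.
have QQ3 : {subset Q' <= Q3}.
  by move=> q qQ'; rewrite -(swapK q) mem_swap QQ2 // mem_swap.
exists Q3; split.
- by have := extends_swap PQ2; rewrite map_swapK.
- by move=> q /QQ'/QQ3.
- by move=> /xQ'/mapP[q /QQ3 qQ3 ->]; apply: map_f.
- move=> _; have /mapP[q qQ2 ->] := yQ2.
  by apply/mapP; exists (swap q) => //; apply: map_f.
Qed.

(** In an increasing chain of finite extensions, stage [n] absorbs the vertices numbered [n] on both
    sides. The union [G] of the chain is the graph of a bijection from [D1] to [D2]. *)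
Lemma back_and_forth : exists f : V1 -> V2,
  [/\ set_bij D1 D2 f, {in D1 &, forall x y, e2 (f x) (f y) = e1 x y} &
      {in P, forall p, f p.1 = p.2}].
Proof.
have [h1 h1I] := countable_injP _ c1.
have [h2 h2I] := countable_injP _ c2.
pose good := {Q | extends e1 e2 P Q}.
have stepP n (Q : good) : exists Q' : good, [/\ {subset sval Q <= sval Q'},
    forall x, h1 x = n -> D1 x -> x \in map fst (sval Q') &
    forall y, h2 y = n -> D2 y -> y \in map snd (sval Q')].
  (* There may be no vertex numbered [n]; the option is then [None], and a coordinate of [p0], which
     is already covered, fills in. *)
  have pick (T : choiceType) (h : T -> nat) : {in setT &, injective h} ->
      exists x : option T, forall x', h x' = n -> x = Some x'.
    move=> hI; case: (pselect (exists x, h x = n)) => [[x hx]|nx].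
      by exists (Some x) => x' hx'; congr Some; apply: hI; rewrite ?inE ?hx.
    by exists None => x' hx'; case: nx; exists x'.
  have [ox oxP] := pick _ _ h1I; have [oy oyP] := pick _ _ h2I.
  have [p0 p0P] : exists p, p \in P.
    by case: (P) P0 => // p0 P' _; exists p0; rewrite mem_head.
  have [Q' [PQ' QQ' xQ' yQ']] :=
    back_and_forth_step (odflt p0.1 ox) (odflt p0.2 oy) (svalP Q).
  exists (exist _ Q' PQ'); split=> //=.
    by move=> x /oxP xE; move: xQ'; rewrite xE.
  by move=> y /oyP yE; move: yQ'; rewrite yE.
have [step {}stepP] := choice (fun nQ : nat * good => stepP nQ.1 nQ.2).
have PP : extends e1 e2 P P.
  by split=> // p pP; exists p => //; split; apply: joined_refl.
pose fix chain n : good :=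
  if n is m.+1 then step (m, chain m) else exist _ P PP.
pose C n := sval (chain n).
have Cmono m n : m <= n -> {subset C m <= C n}.
  elim: n => [|n IHn]; first by rewrite leqn0 => /eqP->.
  rewrite leq_eqVlt => /predU1P[->//|/IHn sub q /sub qC].
  by have [/(_ _ qC)] := stepP (n, chain n).
pose G p := exists n, p \in C n.
have Gpair p q : G p -> G q -> exists n, p \in C n /\ q \in C n.
  move=> [m pm] [n qn]; exists (maxn m n); split.
    by apply: Cmono pm; apply: leq_maxl.
  by apply: Cmono qn; apply: leq_maxr.
have GD p : G p -> D1 p.1 /\ D2 p.2.
  case=> n pn; have [_ _ /(_ _ pn)[q qP [q1 q2]]] := svalP (chain n).
  by split; exists q.
have Ginj p q : G p -> G q -> (p.1 == q.1) = (p.2 == q.2).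
  move=> Gp Gq; have [n [pn qn]] := Gpair _ _ Gp Gq.
  by have [_ [inj _ _ _] _] := svalP (chain n); apply: inj.
have Gadj p q : G p -> G q -> e1 p.1 q.1 = e2 p.2 q.2.
  move=> Gp Gq; have [n [pn qn]] := Gpair _ _ Gp Gq.
  by have [_ [_ adj _ _] _] := svalP (chain n); apply: adj.
(* Outside [D1] the total function [f] takes an arbitrary value, here a second coordinate of [P]. *)
have dom x : exists y, D1 x -> G (x, y).
  case: (pselect (D1 x)) => [Dx|nDx]; last first.
    by case: (P) P0 => // p ? _; exists p.2.
  have [_ /(_ x erefl Dx)/mapP[[x' y] xy /= -> ] _] :=
    stepP (h1 x, chain (h1 x)).
  by exists y => _; exists (h1 x).+1.
have [f fP] := choice dom; exists f; split.
- split.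
  + by move=> x /fP /GD[].
  + move=> x y /[!inE] Dx Dy fxy; apply/eqP.
    by rewrite (Ginj _ _ (fP _ Dx) (fP _ Dy)) /= fxy.
  + move=> y Dy; have [_ _ /(_ y erefl Dy)/mapP[[x y'] xy /= yy']] :=
      stepP (h2 y, chain (h2 y)).
    have Gxy : G (x, y') by exists (h2 y).+1.
    have Dx := (GD _ Gxy).1; exists x => //; apply/eqP.
    by rewrite yy' -(Ginj _ _ (fP _ Dx) Gxy).
- by move=> x y /[!inE] Dx Dy; rewrite -(Gadj _ _ (fP _ Dx) (fP _ Dy)).
- move=> p pP; have Gp : G p by exists 0.
  have Dp := (GD _ Gp).1.
  by apply/eqP; rewrite -(Ginj _ _ (fP _ Dp) Gp).
Qed.

End BackAndForth.

(** * Components of the regular tree *)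

Section RegularTree.
Variables (V : choiceType) (adj : rel V).
Hypothesis HT : regular_tree adj.
Implicit Types (S M : set V) (E : set (V * V)).

Lemma adj_sym : symmetric adj. Proof. by case: HT => -[]. Qed.
Lemma adj_irr : irreflexive adj. Proof. by case: HT => -[]. Qed.
Lemma adj_joined x y : joined adj x y. Proof. by case: HT => -[]. Qed.
Lemma adj_acyclic : acyclic adj. Proof. by case: HT => -[]. Qed.
Lemma adj_inhabited : exists x : V, True. Proof. by case: HT => -[]. Qed.

Lemma adj_infinite x : infinite_set [set y | adj x y].
Proof.
move=> fin; apply: infinite_nat; case: HT => _ /(_ x).
by rewrite card_eq_le => /andP[_ /card_le_finite]; apply.
Qed.

(** [ball n] collects the ends of the walks of exactly [n] steps from [x0]: each is countable, and
    connectedness makes them exhaust [V]. *)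
Lemma vertices_countable : countable [set: V].
Proof.
have [x0 _] := adj_inhabited.
pose fix ball n : set V :=
  if n is m.+1 then \bigcup_(x in ball m) [set y | adj x y] else [set x0].
have cball n : countable (ball n).
  elim: n => [|n IHn] /=; first exact: countable1.
  apply: bigcup_countable => // x _; case: HT => _ /(_ x).
  by rewrite card_eq_le => /andP[].
have -> : [set: V] = \bigcup_(n in setT) ball n; last exact: bigcup_countable.
apply/seteqP; split=> // y _; have := adj_joined x0 y.
apply: (joined_ind (Q := \bigcup_(n in setT) ball n)) => [|a b ab [n _ na]].
  by exists 0.
by exists n.+1 => //; exists a.
Qed.

Definition remove_edges (e : rel V) E : rel V :=
  [rel a b | [&& e a b, (a, b) \notin E & (b, a) \notin E]].

Lemma remove_edgesP (e : rel V) E a b :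
  reflect [/\ e a b, ~ E (a, b) & ~ E (b, a)] (remove_edges e E a b).
Proof.
by apply: (iffP and3P) => -[eab]; rewrite !notin_setE.
Qed.

Lemma remove_edges_sub e E : subrel (remove_edges e E) e.
Proof. by move=> a b /and3P[]. Qed.

Lemma remove_edges_sym e E : symmetric e -> symmetric (remove_edges e E).
Proof.
by move=> es a b; rewrite /remove_edges /= es; congr andb; rewrite andbC.
Qed.

Lemma components_withoutE (e : rel V) E : components_without e E =
  range (fun x => [set y | joined (remove_edges e E) x y]).
Proof. by []. Qed.

Lemma component_joined (e : rel V) x y z : symmetric e ->
  joined e x y -> joined e x z ->
  joined (restrict_rel e [set y | joined e x y]) y z.
Proof.
move=> es xy; pose S := [set y | joined e x y].
have toS t : joined e x t -> joined (restrict_rel e S) x t.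
  move=> xt; suff [] : S t /\ joined (restrict_rel e S) x t by [].
  move: xt; apply: (joined_ind (Q := fun t => S t /\ joined _ x t)).
    by split; apply: joined_refl.
  move=> a b ab [Sa xa]; have Sb : S b := joined_trans Sa (joined_edge ab).
  by split=> //; apply: joined_trans xa (joined_edge _); apply/restrict_relP.
move=> xz; apply: joined_trans (toS _ xz).
by apply: joined_sym; [apply: restrict_sym | apply: toS].
Qed.

Lemma component_eq (e : rel V) x y : symmetric e -> joined e x y ->
  [set z | joined e x z] = [set z | joined e y z].
Proof.
move=> es xy; apply/seteqP; split=> z; last exact: joined_trans.
by apply: joined_trans; apply: joined_sym.
Qed.

(** Back and forth from the single pair [(x, x)], between T and its restriction to [S]. *)
Lemma subtree_restrict S x : S x ->
  (forall y, S y -> infinite_set [set z | adj y z /\ S z]) ->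
  subtree adj S -> exists f, tree_iso adj [set: V] S f.
Proof.
move=> Sx inf [_ conS].
have iso : partial_iso adj (restrict_rel adj S) [:: (x, x)].
  split=> p q; rewrite !inE => /eqP-> /eqP-> //=; try by move=> _; apply: joined_refl.
  by rewrite (restrict_irr S adj_irr) adj_irr.
have D1 : [set y | exists2 p, p \in [:: (x, x)] & joined adj p.1 y] = setT.
  by apply/seteqP; split=> // y _; exists (x, x); rewrite ?inE //=; apply: adj_joined.
have D2 : [set y | exists2 p, p \in [:: (x, x)] &
    joined (restrict_rel adj S) p.2 y] = S.
  apply/seteqP; split=> y.
    by case=> p; rewrite inE => /eqP-> /=; apply: joined_restrict_end.
  by move=> Sy; exists (x, x); rewrite ?inE //=; apply: conS.
have [||||||||f] := @back_and_forth V V adj (restrict_rel adj S)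
  adj_sym adj_irr adj_acyclic _ _ _ _ _ [:: (x, x)] iso _ _ _.
- exact/restrict_sym/adj_sym.
- exact/restrict_irr/adj_irr.
- exact: acyclic_sub (@restrict_sub _ adj S) adj_acyclic.
- exact: vertices_countable.
- exact: vertices_countable.
- by [].
- by move=> y _; apply: adj_infinite.
- rewrite D2 => y Sy; have := inf _ Sy; apply: contra_not; apply: sub_finite_set.
  by move=> z [yz Sz]; apply: (introT (restrict_relP _ _ _ _)).
rewrite D1 D2 => -[fbij fadj _]; exists f; split=> // y z yT zT.
rewrite -(fadj y z) //; apply/idP/restrict_relP => [fyz|[]//].
by case: fbij => fS _ _; split=> //; apply: fS.
Qed.

(** Every edge that leaves the component belongs to [E] in one of its orientations. So the boundary
    is finite, and each vertex keeps infinitely many neighbours inside. *)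
Lemma component_T_subtree E x : finite_set E ->
  T_subtree adj [set y | joined (remove_edges adj E) x y].
Proof.
move=> finE; set e := remove_edges adj E; set S := [set y | _].
have es : symmetric e := remove_edges_sym E adj_sym.
have Sx : S x by apply: joined_refl.
have leave a b : adj a b -> S a -> ~ S b -> E (a, b) \/ E (b, a).
  move=> ab Sa nSb; apply: contrapT => /not_orP[nE1 nE2]; apply: nSb.
  by apply: joined_trans Sa (joined_edge _); apply/remove_edgesP.
have treeS : subtree adj S.
  split; first by exists x.
  move=> y z Sy Sz; have := component_joined es Sy Sz.
  by apply: joined_sub => a b /restrict_relP[/remove_edges_sub ab ? ?]; apply/restrict_relP.
split=> //.
- apply: subtree_restrict Sx _ treeS => y Sy fin; apply: (adj_infinite (x := y)).
  apply: (@sub_finite_set _ _ ([set z | adj y z /\ S z] `|` (snd @` E `|` fst @` E))).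
    move=> z /= yz; case: (pselect (S z)) => Sz; [by left | right].
    by case: (leave _ _ yz Sy Sz) => ?; [left | right]; [exists (y, z) | exists (z, y)].
  by rewrite !finite_setU; split=> //; split; apply: finite_image.
- apply: (@sub_finite_set _ _ (E `|` (fun p => (p.2, p.1)) @` E)).
    move=> [a b] [/= ab Sa Sb]; case: (leave _ _ ab Sa Sb) => ?; [by left | right].
    by exists (b, a).
  by rewrite finite_setU; split=> //; apply: finite_image.
Qed.

Lemma components_disjoint (e : rel V) : symmetric e ->
  trivIset (range (fun x => [set y | joined e x y])) id.
Proof.
move=> es _ _ [x _ <-] [y _ <-] [z [/= xz yz]].
by rewrite (component_eq es xz) (component_eq es yz).
Qed.

(** For finiteness: a path to [x0] from a component that misses [x0] leaves it along a removed edge,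
    so the component contains an end of an edge of [E]. *)
Lemma components_covering E : finite_set E ->
  covering_forest adj (components_without adj E).
Proof.
move=> finE; set e := remove_edges adj E.
have es : symmetric e := remove_edges_sym E adj_sym.
have [x0 _] := adj_inhabited.
split; last by exists E.
- apply: (@sub_finite_set _ _ ((fun x => [set y | joined e x y]) @`
      ([set x0] `|` (fst @` E `|` snd @` E)))); last first.
    by apply: finite_image; rewrite !finite_setU; split; [|split];
      [exact: finite_set1 | apply: finite_image ..].
  move=> _ [x _ <-]; case: (pselect (joined e x x0)) => [xx0|nxx0].
    by exists x0; [left | rewrite (component_eq es xx0)].
  have [a [b [ab xa nxb]]] := joined_exit (S := [set y | joined e x y])
    (joined_refl e x) nxx0 (adj_joined x x0).
  exists a; last by rewrite -(component_eq es xa).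
  right; apply: contrapT => /not_orP[nE1 nE2]; apply: nxb.
  apply: joined_trans xa (joined_edge _); apply/remove_edgesP; split=> // abE.
    by apply: nE1; exists (a, b).
  by apply: nE2; exists (b, a).
- exact: components_disjoint.
- by move=> _ [x _ <-]; apply: component_T_subtree.
Qed.

End RegularTree.

(** * Spheromorphisms and perfect forests *)

Section Components.
Variables (V : choiceType) (adj : rel V).
Hypothesis HT : regular_tree adj.
Implicit Types (F : set (set V)) (E : set (V * V)).

Lemma same_tree_components (e : rel V) x y : symmetric e ->
  same_tree (range (fun x => [set y | joined e x y])) x y <-> joined e x y.
Proof.
move=> es; split=> [[_ [z _ <-] [/= zx zy]]|xy].
  by apply: joined_trans zy; apply: joined_sym.
by exists [set y | joined e x y]; [exists x | split=> //; apply: joined_refl].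
Qed.

Lemma covering_forest_same_tree F : covering_forest adj F ->
  exists e : rel V, [/\ symmetric e,
    F = range (fun x => [set y | joined e x y]) &
    forall x y, same_tree F x y <-> joined e x y].
Proof.
case=> _ _ _ [E finE ->]; exists (remove_edges adj E).
have es := remove_edges_sym E (adj_sym HT); split=> // x y.
exact: same_tree_components.
Qed.

Lemma same_tree_sym F x y : same_tree F x y -> same_tree F y x.
Proof. by case=> S FS [Sx Sy]; exists S. Qed.

Lemma covering_forest_eq F F' : covering_forest adj F ->
  covering_forest adj F' ->
  (forall x y, same_tree F x y <-> same_tree F' x y) -> F = F'.
Proof.
move=> /covering_forest_same_tree[e [_ FE eF]].
move=> /covering_forest_same_tree[e' [_ FE' eF']] FF'.
rewrite FE FE'; suff -> : (fun x => [set y | joined e x y]) =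
  (fun x => [set y | joined e' x y]) by [].
apply/funext => x; apply/predeqP => y /=.
by rewrite -eF FF'.
Qed.

(** Removing edges can only split trees, so a perfect forest is the coarsest compatible one; two
    perfect forests then refine each other. *)
Lemma perfect_forest_refines g F F' x y :
  perfect_forest adj g F -> compatible adj g F' ->
  same_tree F' x y -> same_tree F x y.
Proof.
move=> [[cF _] /[apply] -[E _ F'E]].
have [e [es _ eF]] := covering_forest_same_tree cF.
have fs : symmetric (forest_rel adj F).
  move=> a b; rewrite /forest_rel /= (adj_sym HT); congr andb.
  by apply: asbool_equiv_eq; split; apply: same_tree_sym.
rewrite F'E => /(same_tree_components x y (remove_edges_sym E fs)).
apply: (joined_ind (Q := fun y => same_tree F x y)).
  by apply/eF; apply: joined_refl.
move=> a b /remove_edges_sub/andP[_ /asboolP/eF ab] /eF xa.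
by apply/eF; apply: joined_trans ab.
Qed.

Lemma perfect_forest_unique g F F' :
  perfect_forest adj g F -> perfect_forest adj g F' -> F = F'.
Proof.
move=> pF pF'; apply: covering_forest_eq pF.1.1 pF'.1.1 _ => x y.
split; first exact: perfect_forest_refines pF' pF.1.
exact: perfect_forest_refines pF pF'.1.
Qed.

End Components.

(** * Spheromorphisms as bijections altering finitely many edges *)

Section Hier.
Variables (V : choiceType) (adj : rel V).
Hypothesis HT : regular_tree adj.
Implicit Types (F : set (set V)) (E : set (V * V)) (g : V -> V).

Definition altered g : set (V * V) :=
  [set p | adj p.1 p.2 != adj (g p.1) (g p.2)].

Definition almost_automorphism g : Prop := bijective g /\ finite_set (altered g).

Definition black g : rel V := [rel a b | adj a b && adj (g a) (g b)].

Lemma black_sym g : symmetric (black g).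
Proof. by move=> a b; rewrite /black /= !(adj_sym HT a) (adj_sym HT (g a)). Qed.

Lemma pullback_joined g x y : bijective g -> joined (relpre g adj) x y.
Proof.
case=> h gK hK; rewrite -(gK x) -(gK y).
apply: joined_map (adj_joined HT (g x) (g y)) => a b ab.
by rewrite /= !hK.
Qed.

(** By [joined_adjacent], an edge of T or of its pullback whose ends lie in one black component is
    itself black. Hence [g] is an isomorphism on each black component. *)
Lemma joined_black g x y : bijective g -> joined (black g) x y ->
  adj x y = adj (g x) (g y).
Proof.
move=> /bij_inj gI xy; apply/idP/idP => [ax|gax].
  have : black g x y; last by case/andP.
  apply: (joined_adjacent (adj_sym HT) (adj_acyclic HT) _ (adj_irr HT) xy ax).
  by move=> a b /andP[].
have : black g x y; last by case/andP.
apply: (@joined_adjacent _ (relpre g adj) _ _ _ _ _ _ _ xy gax).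
- by move=> a b; apply: (adj_sym HT).
- exact: acyclic_preim gI (adj_acyclic HT).
- by move=> a b /andP[].
- by move=> a; apply: (adj_irr HT).
Qed.

Definition forest g : set (set V) :=
  range (fun x => [set y | joined (black g) x y]).

Lemma forestE g : forest g = components_without adj (altered g).
Proof.
rewrite /forest; suff -> : black g = remove_edges adj (altered g) by [].
apply/funext => a; apply/funext => b; apply/idP/remove_edgesP.
  case/andP=> ab gab; split=> //= /negP; apply; first by rewrite ab gab.
  by rewrite !(adj_sym HT b) (adj_sym HT (g b)) ab gab.
move=> [ab /negP nE _]; rewrite /black /= ab /=; move: nE.
by rewrite negbK /= ab => /eqP <-.
Qed.

Lemma forest_covering g : almost_automorphism g -> covering_forest adj (forest g).
Proof. by rewrite forestE => -[_]; apply: components_covering. Qed.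

Lemma same_tree_forest g x y : same_tree (forest g) x y <-> joined (black g) x y.
Proof. exact/same_tree_components/black_sym. Qed.

(** For maximality: an edge surviving in a compatible forest is preserved by the embedding of its
    tree, hence black. Removing [E] from T or from the forest of [g] thus leaves the same edges, and
    the [E] that defines the compatible forest is the witness. *)
Lemma forest_perfect g : almost_automorphism g -> perfect_forest adj g (forest g).
Proof.
move=> ag; have [gB _] := ag; split; last first.
  move=> F' [cF' emb]; have [_ _ _ [E finE F'E]] := cF'.
  exists E => //; rewrite F'E !components_withoutE.
  suff -> : remove_edges adj E = remove_edges (forest_rel adj (forest g)) E by [].
  apply/funext => a; apply/funext => b; apply/idP/idP; last first.
    by move=> /remove_edgesP[/andP[ab _] nE nE']; apply/remove_edgesP.
  move=> eab; have /remove_edgesP[ab nE nE'] := eab; apply/remove_edgesP.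
  split=> //; rewrite /forest_rel /= ab; apply/asboolP/same_tree_forest.
  apply: joined_edge; rewrite /black /= ab /=.
  have F'a : F' [set y | joined (remove_edges adj E) a y].
    by rewrite F'E; exists a.
  have [_ emb_edge] := emb _ F'a.
  apply: emb_edge => //; rewrite inE; first exact: joined_refl.
  exact: joined_edge.
split; first exact: forest_covering.
move=> _ [x _ <-]; split; first by move=> a b _ _; apply: (bij_inj gB).
move=> a b /[!inE] /= xa xb ab; rewrite -(joined_black gB) //.
by apply: joined_trans xb; apply: joined_sym xa; apply: black_sym.
Qed.

(** The target forest consists of the images of the black components. These are the components of T
    after removal of [E'], the image of the altered edges, because the edges outside [E'] are
    exactly the images of black edges. *)
Lemma almost_automorphism_spheromorphism g :
  almost_automorphism g -> spheromorphism adj g.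
Proof.
move=> ag; have [gB finE] := ag; have gI := bij_inj gB.
have cF := forest_covering ag; have [/finite_setP[n Fn] _ _ _] := cF.
have [S [SF SI SS]] : exists S : 'I_n -> set V, set_bij setT (forest g) S.
  by apply/card_set_bijP; rewrite card_eq_sym; apply: card_eq_trans Fn card_II.
have rS : range S = forest g.
  apply/seteqP; split=> [_ [j _ <-]|_ /SS[j _ <-]]; first exact: SF.
  by exists j.
have imI : injective (fun A : set V => g @` A).
  move=> A B AB; apply/predeqP => x; split=> Ax.
    have : (g @` B) (g x) by rewrite -AB; exists x.
    by case=> y By /gI <-.
  have : (g @` A) (g x) by rewrite AB; exists x.
  by case=> y By /gI <-.
exists n, S, (fun j => g @` S j); split.
- by move=> i j; apply: SI; rewrite inE.
- by move=> i j /imI; apply: SI; rewrite inE.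
- by rewrite rS.
- pose E' := (fun p => (g p.1, g p.2)) @` altered g.
  have finE' : finite_set E' by apply: finite_image.
  suff -> : range (fun j => g @` S j) = components_without adj E'.
    exact: components_covering.
  have [h gK hK] := gB.
  have remE a b : remove_edges adj E' (g a) (g b) = black g a b.
    have E'g u v : E' (g u, g v) <-> altered g (u, v).
      split=> [[[u' v'] uv [/gI uu /gI vv]]|uv]; last by exists (u, v).
      by rewrite -uu -vv.
    apply/remove_edgesP/andP => [[gab /E'g nE _]|[ab gab]].
      by split=> //; move/negP: nE; rewrite negbK /= gab => /eqP.
    split=> // /E'g/negP; apply=> /=; first by rewrite ab gab.
    by rewrite !(adj_sym HT b) (adj_sym HT (g b)) ab gab.
  have imE x : g @` [set y | joined (black g) x y] =
      [set y | joined (remove_edges adj E') (g x) y].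
    apply/seteqP; split=> [_ [y xy <-]|y gxy] /=.
      by apply: joined_map xy => a b; rewrite remE.
    exists (h y) => //=; rewrite -[x]gK.
    by apply: joined_map gxy => a b; rewrite -{1}[a]hK -{1}[b]hK remE.
  apply/seteqP; split=> [_ [j _ <-]|_ [y _ <-]].
    have [x _ <-] := SF j I; rewrite imE; first by exists (g x).
  have [j _ jE] := SS [set z | joined (black g) (h y) z] (ex_intro2 _ _ _ I erefl).
  by exists j => //; rewrite jE imE hK.
- move=> j; split.
    by split=> [x Sx|x y _ _ /gI//|_ [x Sx <-]]; exists x.
  have [x _ <-] := SF j I => a b /[!inE] /= xa xb.
  rewrite -(joined_black gB) //.
  by apply: joined_trans xb; apply: joined_sym xa; apply: black_sym.
Qed.

(** Adjacency is preserved inside each tree [S j], so an altered pair either is an edge removed in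
    the source or maps to an edge removed in the target. *)
Lemma spheromorphism_almost_automorphism g :
  spheromorphism adj g -> almost_automorphism g.
Proof.
case=> n [S [R [SI RI cS cR iso]]].
have inS x : exists j, S j x.
  have [e [_ Se eS]] := covering_forest_same_tree HT cS.
  by have [_ [j _ <-] [Sx _]] := (eS x x).2 (joined_refl _ _); exists j.
have inR x : exists j, R j x.
  have [e [_ Re eR]] := covering_forest_same_tree HT cR.
  by have [_ [j _ <-] [Rx _]] := (eR x x).2 (joined_refl _ _); exists j.
have RS x j : R j (g x) -> S j x.
  move=> Rgx; have [i Six] := inS x; have [[SR _ _] _] := iso i.
  suff -> : j = i by [].
  apply: RI; case: cR => _ dR _ _.
  apply: dR; [by exists j | by exists i | exists (g x); split=> //].
  exact: SR.
have gI : injective g.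
  move=> x y gxy; have [i Six] := inS x; have [[SR Sinj _] _] := iso i.
  by apply: Sinj (gxy); rewrite inE //; apply: RS; rewrite -gxy; apply: SR.
have gS y : exists x, g x = y.
  have [j Ry] := inR y; have [[_ _ Ssurj] _] := iso j.
  by have [x _ <-] := Ssurj _ Ry; exists x.
have [h hK] := choice gS.
have gB : bijective g by exists h => // x; apply: gI; rewrite hK.
split=> //; case: cS => _ _ _ [E finE SE]; case: cR => _ _ _ [E' finE' RE].
have same a b (e : V * V -> Prop) (X : 'I_n -> set V) :
    range X = components_without adj e -> adj a b ->
    e (a, b) \/ e (b, a) \/ exists j, X j a /\ X j b.
  move=> XE ab; apply: contrapT => /not_orP[n1 /not_orP[n2 n3]]; apply: n3.
  have [j _ jE] : range X [set y | joined (remove_edges adj e) a y].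
    by rewrite XE; exists a.
  exists j; rewrite jE; split; first exact: joined_refl.
  by apply: joined_edge; apply/remove_edgesP.
pose sw (p : V * V) := (p.2, p.1).
pose im (p : V * V) := (h p.1, h p.2).
(* The edges removed on either side, those of the target pulled back by [h], each in both
   orientations. *)
apply: (@sub_finite_set _ _ (E `|` (sw @` E `|` (im @` E' `|` (sw \o im) @` E')))).
  move=> [a b]; rewrite /altered /=.
  have [ab|nab] := boolP (adj a b) => alt.
    have [Eab|[Eba|[j [Sa Sb]]]] := same a b E S SE ab.
    - by left.
    - by right; left; exists (b, a).
    - have [_ /(_ a b)] := iso j; rewrite !inE => /(_ Sa Sb) gab.
      by rewrite gab ab in alt.
  have gab : adj (g a) (g b) by case: (adj _ _) alt.
  have hg x : h (g x) = x by apply: gI.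
  have [Eab|[Eba|[j [Ra Rb]]]] := same (g a) (g b) E' R RE gab.
  - by right; right; left; exists (g a, g b) => //; rewrite /im /= !hg.
  - by right; right; right; exists (g b, g a) => //; rewrite /im /sw /= !hg.
  - have [_ /(_ a b)] := iso j; rewrite !inE gab => /(_ (RS _ _ Ra) (RS _ _ Rb)).
    by move=> ab; rewrite -ab in nab.
by rewrite !finite_setU; do !split=> //; apply: finite_image.
Qed.

Lemma blue_edge_forest g x y : bijective g ->
  blue_edge adj (forest g) x y <-> adj x y /\ ~~ adj (g x) (g y).
Proof.
move=> gB; split=> -[xy].
  rewrite same_tree_forest => nxy; split=> //; apply/negP => gxy; apply: nxy.
  by apply: joined_edge; rewrite /black /= xy.
move=> ngxy; split=> // /same_tree_forest/(joined_black gB) xyE.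
by rewrite -xyE xy in ngxy.
Qed.

Lemma red_edge_forest g x y : bijective g ->
  red_edge adj g (forest g) (g x) (g y) <-> adj (g x) (g y) /\ ~~ adj x y.
Proof.
move=> gB; have gI := bij_inj gB.
have imE : same_tree [set g @` S | S in forest g] (g x) (g y) <->
    joined (black g) x y.
  rewrite -same_tree_forest; split=> [|[S FS [Sx Sy]]].
    move=> [_ [S FS <-] [[x' Sx /gI xx] [y' Sy /gI yy]]].
    by exists S => //; rewrite -xx -yy.
  exists (g @` S); first by exists S.
  by split; [exists x | exists y].
rewrite /red_edge imE; split=> -[gxy nxy]; split=> //.
  apply/negP => xy; apply: nxy; apply: joined_edge.
  by rewrite /black /= xy.
by move/(joined_black gB) => xyE; rewrite xyE gxy in nxy.
Qed.

End Hier.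

(** * Existence of a bi-tree *)

Section ConnectedSets.
Variable W : choiceType.
Implicit Types (e : rel W) (M N : set W).

Lemma joined_neighbor e x y : joined e x y -> x <> y -> exists z, e x z.
Proof. by case=> -[|z p] /= + <- // => /andP[xz _]; exists z. Qed.

Lemma joined_pullback (W' : choiceType) (h : W -> W') (e : rel W') N x y :
  injective h -> joined (restrict_rel e (h @` N)) (h x) (h y) ->
  joined (restrict_rel (relpre h e) N) x y.
Proof.
move=> hI xy; pose Q v := exists2 z, h z = v & joined (restrict_rel (relpre h e) N) x z.
suff [z /hI <-//] : Q (h y).
move: xy; apply: (joined_ind (Q := Q)); first by exists x => //; apply: joined_refl.
move=> a b /restrict_relP[ab Na [z Nz zb]] [t ta xt]; exists z => //.
apply: joined_trans xt (joined_edge _); apply/restrict_relP.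
by split=> //; [rewrite /= ta zb | case: Na => t' Nt'; rewrite -ta => /hI <-].
Qed.

(* Follow an e'-path: it leaves a component of the common edges only through
   edges of e' alone, whose ends are in M. *)
Lemma connected_transfer e e' M : symmetric e -> acyclic e ->
  (forall x y, M x -> M y -> joined (restrict_rel e M) x y) ->
  (forall x y, e' x y -> ~~ e x y -> M x /\ M y) ->
  forall x y, M x -> M y -> joined e' x y -> joined (restrict_rel e' M) x y.
Proof.
move=> es ac conM diffM x y Mx My xy.
pose b : rel W := [rel u v | e u v && e' u v].
have bM u v : M u -> M v -> joined b u v -> joined (restrict_rel e' M) u v.
  move=> Mu Mv uv; have be : subrel b e by move=> s t /andP[].
  have := subtree_convex es ac be (conM _ _ Mu Mv) uv Mu.
  by apply: joined_sub => s t /restrict_relP[/andP[_ ?] ? ?]; apply/restrict_relP.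
suff : forall m, M m -> joined b y m -> joined (restrict_rel e' M) x m.
  by apply=> //; apply: joined_refl.
move: xy; apply: (joined_ind (Q := fun v => forall m, M m -> joined b v m ->
  joined (restrict_rel e' M) x m)); first by move=> m Mm; apply: bM.
move=> u v uv IHu m Mm vm; case: (boolP (e u v)) => euv.
  apply: IHu => //; apply: joined_trans (joined_edge _) vm.
  by rewrite /b /= euv.
have [Mu Mv] := diffM _ _ uv euv.
apply: joined_trans (IHu u Mu (joined_refl _ _)) _.
apply: joined_trans (joined_edge _) (bM _ _ Mv Mm vm).
exact/restrict_relP.
Qed.

(** A walk enters and leaves [x] only through [c], so a visit to [x] can be cut out. *)
Lemma connected_remove_leaf e M x c : symmetric e -> irreflexive e ->
  (forall y, M y -> e x y -> y = c) ->
  forall a b, a <> x -> b <> x -> joined (restrict_rel e M) a b ->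
  joined (restrict_rel e [set y | M y /\ y <> x]) a b.
Proof.
move=> es ei leaf a b ax bx ab; set M' := [set y | _].
(* While the original walk sits at [x], the shortened one waits at [c]. *)
pose Q v := (v <> x -> joined (restrict_rel e M') a v) /\
            (v = x -> joined (restrict_rel e M') a c).
suff [H _] : Q b by apply: H.
move: ab; apply: (joined_ind (Q := Q)); first by split=> // _; apply: joined_refl.
move=> u v /restrict_relP[uv Mu Mv] [Qu1 Qu2]; case: (pselect (u = x)) => ux.
  have vc : v = c by apply: leaf; rewrite // -ux.
  split=> [_|vx]; last exact: Qu2.
  by rewrite vc; apply: Qu2.
split=> vx.
  by apply: joined_trans (Qu1 ux) (joined_edge _); apply/restrict_relP.
have -> : c = u by apply/esym/leaf; rewrite // es -vx.
exact: Qu1.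
Qed.

End ConnectedSets.

(** [N] is enlarged by adjacent vertices, one at a time. The last one added has all its neighbours
    in a connected set, hence only one by [unique_gate]. *)
Lemma leaf_outside (W : finType) (e : rel W) (N : set W) : symmetric e ->
  irreflexive e -> acyclic e -> (forall x y, joined e x y) -> N !=set0 ->
  (forall x y, N x -> N y -> joined (restrict_rel e N) x y) -> N <> setT ->
  exists x, ~ N x /\ exists y, forall z, e x z = (z == y).
Proof.
move=> es ei ac con; move: {2}_.+1 (ltnSn #|[pred x | `[< ~ N x >]]|) => n.
elim: n N => // n IHn N; rewrite ltnS => ltn [x0 Nx0] conN NT.
have [y nNy] : exists y, ~ N y.
  apply: contrapT => none; apply: NT; apply/seteqP; split=> // x _.
  by apply: contrapT => nNx; apply: none; exists x.
have [a [x [ax Na nNx]]] := joined_exit Nx0 nNy (con x0 y).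
pose N' := [set z | N z \/ z = x].
have conN' u v : N' u -> N' v -> joined (restrict_rel e N') u v.
  have sub u' v' : N u' -> N v' -> joined (restrict_rel e N') u' v'.
    move=> Nu Nv; apply: joined_sub (conN _ _ Nu Nv) => s t.
    by apply: restrict_subset => ?; left.
  have axN' : joined (restrict_rel e N') a x.
    by apply: joined_edge; apply/restrict_relP; split=> //; [left | right].
  have toa u' : N' u' -> joined (restrict_rel e N') a u'.
    by case=> [Nu'|->//]; apply: sub.
  move=> /toa au /toa av; apply: joined_trans av.
  by apply: joined_sym au; apply: restrict_sym.
case: (pselect (N' = setT)) => [N'T|N'nT].
  exists x; split=> //; exists a => z; apply/idP/eqP => [xz|->]; last by rewrite es.
  have : N' z by rewrite N'T.
  case=> [Nz|zx]; last by rewrite zx ei in xz.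
  apply: (unique_gate es ac nNx (conN _ _ Nz Na)) => //.
  by rewrite es.
have [||z [nN'z zy]] := IHn N' _ _ conN' N'nT.
- apply: leq_trans ltn; apply: proper_card; apply/properP; split.
    apply/fintype.subsetP => z /asboolP nN'z; apply: asboolT => Nz.
    by apply: nN'z; left.
  exists x; first exact: asboolT.
  by apply/negP => /asboolP; apply; right.
- by exists x0; left.
by exists z; split=> // Nz; apply: nN'z; left.
Qed.

(** * Presentations of a spheromorphism by a bi-tree *)

Section Presentation.
Variables (V : choiceType) (adj : rel V) (I J : set V).
Hypotheses (HT : regular_tree adj).
Implicit Types (g : V -> V).

(* A description of the canonical bi-tree of g that mentions neither hulls nor
   perfect forests; it is transported trivially by automorphisms of T. *)
Definition presents g (B : bitree adj I J) (phi : B -> V) : Prop :=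
  [/\ injective phi,
      forall x y : B, black_blue x y = adj (phi x) (phi y),
      forall x y : B, black_red x y = adj (g (phi x)) (g (phi y)),
      forall a b, altered adj g (a, b) -> exists x, phi x = a &
      (forall x : I, phi (imap B x) = val x) /\
      (forall y : J, g (phi (jmap B y)) = val y)].

Lemma altered_sym g a b : altered adj g (a, b) -> altered adj g (b, a).
Proof. by rewrite /altered /= !(adj_sym HT b) (adj_sym HT (g b)). Qed.

Lemma finite_connected (A : seq V) : exists2 s : seq V, {subset A <= s} &
  forall x y, x \in s -> y \in s -> joined (restrict_rel adj [set` s]) x y.
Proof.
have [r _] := adj_inhabited HT.
suff [s As rs] : exists2 s : seq V, {subset A <= s} &
    forall x, x \in s -> joined (restrict_rel adj [set` s]) r x.
  exists s => // x y /rs rx /rs ry; apply: joined_trans ry.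
  by apply: joined_sym rx; apply/restrict_sym/(adj_sym HT).
elim: A => [|a A [s As rs]]; first by exists [::].
have [p rp pa] := adj_joined HT r a; exists (s ++ r :: p).
  by move=> x; rewrite inE mem_cat => /predU1P[->|/As ->//]; rewrite -pa mem_last orbT.
move=> x; rewrite mem_cat => /orP[xs|xp].
  apply: joined_sub (rs _ xs) => u v; apply: restrict_subset => z /=.
  by rewrite mem_cat => ->.
apply: joined_path xp; apply: path_restrict rp _ => z zp /=.
by rewrite mem_cat zp orbT.
Qed.

Section Existence.
Hypotheses (finI : finite_set I) (finJ : finite_set J) (I0 : I !=set0).
Variable g : V -> V.
Hypothesis ag : almost_automorphism adj g.

Let adj' : rel V := relpre g adj.

(** These are the demands on the vertex set of the bi-tree other than the leaf axiom, which an
    admissible set of least size satisfies by itself. *)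
Definition admissible (s : seq V) : Prop :=
  [/\ uniq s, (forall x, I x -> x \in s) /\ (forall x, J (g x) -> x \in s),
      forall a b, altered adj g (a, b) -> a \in s,
      forall x y, x \in s -> y \in s -> joined (restrict_rel adj [set` s]) x y &
      forall x y, x \in s -> y \in s -> joined (restrict_rel adj' [set` s]) x y].

(** It is enough to enclose the required vertices in a finite set connected in T: containing the
    ends of the altered edges, it is connected in the pullback too, by [connected_transfer]. *)
Lemma admissible_exists : exists s, admissible s.
Proof.
have [gB fa] := ag; have [h gK hK] := gB.
have [A AE] : exists A : seq V, I `|` (h @` J `|` fst @` altered adj g) = [set` A].
  by apply/finite_seqP; rewrite !finite_setU; do !split=> //; apply: finite_image.
have [s0 As0 cons0] := finite_connected A.
pose s := undup s0.
have ss0 : [set` s] = [set` s0] by apply/seteqP; split=> x /=; rewrite mem_undup.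
have inA x : (I `|` (h @` J `|` fst @` altered adj g)) x -> x \in s.
  by rewrite AE mem_undup; apply: As0.
have cons x y : x \in s -> y \in s -> joined (restrict_rel adj [set` s]) x y.
  by rewrite !mem_undup ss0; apply: cons0.
exists s; split=> //; first exact: undup_uniq.
- split=> x Hx; apply: inA; [by left | right; left].
  by exists (g x); rewrite ?gK.
- by move=> a b ab; apply: inA; right; right; exists (a, b).
- move=> x y xs ys; apply: (connected_transfer (adj_sym HT) (adj_acyclic HT) cons) => //.
    move=> a b gab nab; have alt : altered adj g (a, b).
      by rewrite /altered /= (negPf nab) (gab : adj (g a) (g b)).
    split; apply: inA; right; right; first by exists (a, b).
    by exists (b, a) => //; apply: altered_sym.
  exact: pullback_joined.
Qed.

Section Graph.
Variable s : seq V.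

Definition span_col (x y : seq_sub s) : option color :=
  let a := ssval x in let b := ssval y in
  if adj a b then Some (if adj (g a) (g b) then Black else Blue)
  else if adj (g a) (g b) then Some Red else None.

Lemma span_col_sym x y : span_col x y = span_col y x.
Proof. by rewrite /span_col !(adj_sym HT (ssval x)) (adj_sym HT (g (ssval x))). Qed.

Lemma span_col_irr x : span_col x x = None.
Proof. by rewrite /span_col !(adj_irr HT). Qed.

Definition span_graph : colored_graph := ColoredGraph span_col_sym span_col_irr.

Lemma span_black_blue (x y : span_graph) :
  black_blue x y = adj (ssval x) (ssval y).
Proof. by rewrite /black_blue /= /span_col; do 2!case: (adj _ _). Qed.

Lemma span_black_red (x y : span_graph) :
  black_red x y = adj (g (ssval x)) (g (ssval y)).
Proof. by rewrite /black_red /= /span_col; do 2!case: (adj _ _). Qed.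

End Graph.

Lemma span_tree s (e0 : rel V) (e : rel (span_graph s)) : symmetric e0 ->
  irreflexive e0 -> acyclic e0 ->
  (forall x y, x \in s -> y \in s -> joined (restrict_rel e0 [set` s]) x y) ->
  (forall x y, e x y = e0 (ssval x) (ssval y)) ->
  (exists x, x \in s) -> tree e.
Proof.
move=> es ei ac cons eE [x xs].
have vI : injective (@ssval _ s) by exact: val_inj.
have imT : @ssval _ s @` setT = [set` s].
  apply/seteqP; split=> [_ [y _ <-]|y ys]; first exact: ssvalP.
  by exists (SeqSub ys).
split.
- by move=> y z; rewrite !eE es.
- by move=> y; rewrite eE ei.
- by exists (SeqSub xs).
- move=> y z; have := cons _ _ (ssvalP y) (ssvalP z); rewrite -imT.
  move/(joined_pullback vI); apply: joined_sub => u v /restrict_sub /=.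
  by rewrite eE.
- apply: acyclic_sub (acyclic_preim vI ac) => u v.
  by rewrite eE.
Qed.

(** An admissible [s] of least size is taken: a leaf outside I and g^-1 J could be deleted from it,
    against minimality. *)
Lemma presents_exists : exists (B : bitree adj I J) phi, @presents g B phi.
Proof.
have [gB fa] := ag; have [h gK hK] := gB; have gI := bij_inj gB.
have ex : exists n, `[< exists2 s, admissible s & size s = n >].
  by have [s adms] := admissible_exists; exists (size s); apply/asboolP; exists s.
have [n /asboolP[s adms sn] min] := ex_minnP ex.
have [us [Is Js] alts cons cons'] := adms.
have acg : acyclic adj' := acyclic_preim gI (adj_acyclic HT).
have sg : symmetric adj' by move=> a b; apply: (adj_sym HT).
have ig : irreflexive adj' by move=> a; apply: (adj_irr HT).
have [x0 Ix0] := I0; have s0 : exists x, x \in s by exists x0; apply: Is.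
pose im (x : I) : span_graph s := SeqSub (Is _ (set_valP x)).
have Jh (y : J) : J (g (h (val y))) by rewrite hK; apply: set_valP.
pose jm (y : J) : span_graph s := SeqSub (Js _ (Jh y)).
have im_inj : injective im by move=> x y /(congr1 (@ssval _ s))/= /val_inj.
have jm_inj : injective jm.
  by move=> x y /(congr1 (@ssval _ s))/= /(can_inj hK)/val_inj.
have im_edge (x y : I) : adj (val x) (val y) -> black_blue (im x) (im y).
  by rewrite span_black_blue.
have jm_edge (x y : J) : adj (val x) (val y) -> black_red (jm x) (jm y).
  by rewrite span_black_red /= !hK.
have bb : tree (@black_blue (span_graph s)).
  apply: (span_tree (adj_sym HT) (adj_irr HT) (adj_acyclic HT) cons _ s0).
  exact: span_black_blue.
have br : tree (@black_red (span_graph s)).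
  apply: (span_tree sg ig acg cons' _ s0); exact: span_black_red.
have leaf (x : span_graph s) : valence x = 1 ->
    (exists y, col x y = Some Black) /\ (range im x \/ range jm x).
  move=> /mem_card1[c cP]; pose a := ssval x; pose d := ssval c.
  have as_ : a \in s := ssvalP x; have ds : d \in s := ssvalP c.
  have nbr v : v \in s -> adj a v \/ adj (g a) (g v) -> v = d.
    move=> vs av; have := cP (SeqSub vs); rewrite !inE /= /span_col /= -/a => H.
    have : SeqSub vs == c by rewrite -H; case: av => ->; case: (adj _ _).
    by move/eqP/(congr1 (@ssval _ s)).
  have nad : a <> d.
    move=> ad; have := cP x; rewrite !inE col_irr /= => /esym/eqP; apply.
    exact: val_inj.
  (* Connectedness in each tree gives [a] a neighbour there, necessarily [d]; the only edge at [a]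
     is therefore black. *)
  have ad : adj a d.
    have [z /restrict_relP[az _ zs]] := joined_neighbor (cons _ _ as_ ds) nad.
    by rewrite -(nbr z) //; left.
  have gad : adj (g a) (g d).
    have [z /restrict_relP[az _ zs]] := joined_neighbor (cons' _ _ as_ ds) nad.
    by rewrite -(nbr z) //; right.
  split; first by exists c; rewrite /= /span_col ad gad.
  apply: contrapT => /not_orP[nI nJ].
  have nIa : ~ I a.
    by move=> Ia; apply: nI; exists (SigSub (mem_set Ia)) => //; apply: val_inj.
  have nJa : ~ J (g a).
    move=> Ja; apply: nJ; exists (SigSub (mem_set Ja)) => //; apply: val_inj.
    by rewrite /= gK.
  have admr : admissible (rem a s).
    have inr y : (y \in rem a s) = (y != a) && (y \in s) by rewrite mem_rem_uniq.
    have sub : [set y | [set` s] y /\ y <> a] `<=` [set` rem a s].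
      by move=> y [ys /eqP ya] /=; rewrite inr ya.
    split; first exact: rem_uniq.
    - split=> y Hy; rewrite inr.
        by rewrite Is // andbT; apply/eqP => ya; rewrite ya in Hy.
      by rewrite Js // andbT; apply/eqP => ya; rewrite ya in Hy.
    (* An altered edge at [a] would join it to [d], but that edge is black. *)
    - move=> u v uv; rewrite inr (alts _ _ uv) andbT; apply/eqP => ua.
      move: uv; rewrite {}ua => av; have vs := alts _ _ (altered_sym av).
      have vd : v = d.
        apply: nbr => //; move: av; rewrite /altered /=.
        by case: (adj a v); [left | case: (adj (g a) _); [right|]].
      by move: av; rewrite vd /altered /= ad gad.
    - move=> u v; rewrite !inr => /andP[/eqP ua us'] /andP[/eqP va vs].
      apply: joined_sub (connected_remove_leaf (adj_sym HT) (adj_irr HT)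
        _ ua va (cons _ _ us' vs)); last by move=> y ys ay; apply: (nbr y ys); left.
      by move=> y z; apply: restrict_subset.
    - move=> u v; rewrite !inr => /andP[/eqP ua us'] /andP[/eqP va vs].
      apply: joined_sub (connected_remove_leaf sg ig
        _ ua va (cons' _ _ us' vs)); last by move=> y ys ay; apply: (nbr y ys); right.
      by move=> y z; apply: restrict_subset.
  have : n <= size (rem a s) by apply: min; apply/asboolP; exists (rem a s).
  rewrite size_rem // sn; case: n {min ex} sn => [/size0nil s_nil|m _].
    by rewrite s_nil in as_.
  by rewrite /= ltnn.
exists (BiTree im_inj jm_inj im_edge jm_edge bb br leaf), (@ssval _ s).
split=> //.
- exact: val_inj.
- exact: span_black_blue.
- exact: span_black_red.
- by move=> a b ab; exists (SeqSub (alts _ _ ab)).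
- by split=> //= y; apply: hK.
Qed.

End Existence.
End Presentation.

(** * Comparison with the canonical construction *)

Section Canonical.
Variables (V : choiceType) (adj : rel V) (I J : set V).
Hypotheses (HT : regular_tree adj).
Implicit Types (g : V -> V) (S : set V) (F : set (set V)).

(** [hull] is an intersection of subtrees, each of which contains the unique simple path of T
    between any two of its points. *)
Lemma hull_subtree (A : set V) : A !=set0 -> subtree adj (hull adj A).
Proof.
move=> [a Aa]; split; first by exists a; apply: sub_gen_smallest.
move=> x y Ax Ay; have [p [xp up py]] := joined_uniq (adj_joined HT x y).
exists p => //; apply: path_restrict => // z zp S [treeS AS].
have [_ conS] := treeS; have Sx := Ax S (conj treeS AS).
have [q [xq uq qy]] := joined_uniq (conS _ _ Sx (Ay S (conj treeS AS))).
suff pq : p = q by rewrite pq in zp; apply: restrict_path xq _ zp.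
apply: (@unique_path _ adj (adj_sym HT) (adj_acyclic HT) x) => //.
  exact: sub_path (@restrict_sub _ adj S) _ _ xq.
by rewrite py qy.
Qed.

Lemma col_black (G : colored_graph) (x y : G) :
  col x y = Some Black <-> black_blue x y /\ black_red x y.
Proof. by rewrite /black_blue /black_red /=; case: col => [[]|]; split=> // -[]. Qed.

Lemma col_blue (G : colored_graph) (x y : G) :
  col x y = Some Blue <-> black_blue x y /\ ~~ black_red x y.
Proof. by rewrite /black_blue /black_red /=; case: col => [[]|]; split=> // -[]. Qed.

Lemma col_red (G : colored_graph) (x y : G) :
  col x y = Some Red <-> black_red x y /\ ~~ black_blue x y.
Proof. by rewrite /black_blue /black_red /=; case: col => [[]|]; split=> // -[]. Qed.

Lemma col_some (G : colored_graph) (x y : G) :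
  isSome (col x y) = black_blue x y || black_red x y.
Proof. by rewrite /black_blue /black_red /=; case: col => [[]|]. Qed.

Section Presented.
Hypotheses (I0 : I !=set0).
Variables (g : V -> V) (B : bitree adj I J) (phi : B -> V).
Hypotheses (gB : bijective g) (pres : presents g phi).

Let F := forest adj g.
Let M := range phi.
Let C := canonical_vert adj I J g F.

Lemma presents_almost_automorphism : almost_automorphism adj g.
Proof.
split=> //; have [_ _ _ alt _] := pres.
have fM : finite_set M by apply: finite_image; apply: finite_finset.
apply: (sub_finite_set _ (finite_setX fM fM)) => -[a b] ab.
have [x xa] := alt _ _ ab; have [y yb] := alt _ _ (altered_sym HT ab).
by split; [exists x | exists y].
Qed.

Lemma presents_image_subtree : subtree adj M.
Proof.
have [_ bb _ _ _] := pres; have [_ _ [x0 _] con _] := black_blue_tree B.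
split; first by exists (phi x0); exists x0.
move=> _ _ [x _ <-] [y _ <-]; apply: joined_map (con x y) => a b ab.
by apply/restrict_relP; split; [rewrite -bb | exists a | exists b].
Qed.

Lemma presents_image_subtree' : subtree adj (g @` M).
Proof.
have [_ _ br _ _] := pres; have [_ _ [x0 _] con _] := black_red_tree B.
split; first by exists (g (phi x0)); exists (phi x0) => //; exists x0.
move=> _ _ [_ [x _ <-] <-] [_ [y _ <-] <-].
apply: (joined_map (h := g \o phi)) (con x y) => a b ab.
apply/restrict_relP; split; first by rewrite /= -br.
  by exists (phi a) => //; exists a.
by exists (phi b) => //; exists b.
Qed.

(** The range of [phi] is a subtree containing I and the ends of blue edges; its image under [g] is
    a subtree containing J and the ends of red edges. Minimality then bounds each hull of the
    construction. *)
Lemma Xi_image S : Xi adj I J g F S `<=` M.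
Proof.
have [_ _ _ alt [iE jE]] := pres.
have [h gK hK] := gB.
have IM : skel_I adj I F `<=` M.
  apply: smallest_sub; first exact: presents_image_subtree.
  move=> x [Ix|[y /(blue_edge_forest HT _ _ gB)[xy nxy]]].
    by exists (imap B (SigSub (mem_set Ix))); rewrite ?iE.
  have [|u <-] := alt x y; last by exists u.
  by rewrite /altered /= xy (negPf nxy).
have JM : skel_J adj J g F `<=` g @` M.
  apply: smallest_sub; first exact: presents_image_subtree'.
  move=> x [Jx|[y]].
    exists (phi (jmap B (SigSub (mem_set Jx)))); last by rewrite jE.
    by exists (jmap B (SigSub (mem_set Jx))).
  rewrite -[x]hK -[y]hK => /(red_edge_forest HT _ _ gB)[xy nxy].
  have [|u <-] := alt (h x) (h y); last by exists (phi u) => //; exists u.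
  by rewrite /altered /= xy (negPf nxy).
apply: smallest_sub; first exact: presents_image_subtree.
move=> x [[_ /IM//]|[_ /JM[y My /(bij_inj gB) <-]]] //.
Qed.

Lemma Xi_sub S : F S -> Xi adj I J g F S `<=` S.
Proof.
move=> FS; have [_ _ cS _] := forest_covering HT presents_almost_automorphism.
have [treeS _ _] := cS _ FS; apply: smallest_sub => // x [[]//|].
by case=> -[y Sy /(bij_inj gB) <-].
Qed.

Lemma forest_cover x : exists2 S, F S & S x.
Proof.
have [_ /(_ (joined_refl _ x))[S FS [Sx _]]] := same_tree_forest HT g x x.
by exists S.
Qed.

Lemma skel_I_canonical x : skel_I adj I F x -> C x.
Proof.
move=> Ix; have [S FS Sx] := forest_cover x; exists S => //.
by apply: sub_gen_smallest; left.
Qed.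

Lemma skel_J_canonical x : skel_J adj J g F (g x) -> C x.
Proof.
move=> Jx; have [S FS Sx] := forest_cover x; exists S => //.
by apply: sub_gen_smallest; right; split=> //; exists x.
Qed.

Lemma altered_canonical a b : altered adj g (a, b) -> C a.
Proof.
rewrite /altered /=; case: (boolP (adj a b)) => ab.
  move=> gab; apply: skel_I_canonical; apply: sub_gen_smallest; right; exists b.
  by apply/(blue_edge_forest HT _ _ gB); split=> //; move: gab; case: (adj (g a) _).
move=> gab; apply: skel_J_canonical; apply: sub_gen_smallest; right; exists (g b).
by apply/(red_edge_forest HT _ _ gB); split=> //; move: gab; case: (adj (g a) _).
Qed.

(** If [S] misses a point [i] of I, a path from [S] to [i] leaves [S] along a blue edge, whose ends
    lie in the skeleton. *)
Lemma skel_I_meets S : F S -> exists2 z, S z & skel_I adj I F z.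
Proof.
move=> FS; have [x _ SE] := FS; have [i Ii] := I0.
case: (pselect (S i)) => Si; first by exists i => //; apply: sub_gen_smallest; left.
have Sx : S x by rewrite -SE; apply: joined_refl.
have [a [b [ab Sa nSb]]] := joined_exit Sx Si (adj_joined HT x i).
exists a => //; apply: sub_gen_smallest; right; exists b; split=> //.
move=> /(same_tree_forest HT) jab; apply: nSb; move: Sa; rewrite -SE => xa.
exact: joined_trans xa jab.
Qed.

(** Each [Xi] is connected and meets the subtree [skel_I], which lies in [C]. *)
Lemma canonical_connected x y : C x -> C y -> joined (restrict_rel adj C) x y.
Proof.
have toskel u : C u -> exists2 z, skel_I adj I F z & joined (restrict_rel adj C) u z.
  move=> [S FS Xu]; have [z Sz Iz] := skel_I_meets FS.
  have Xz : Xi adj I J g F S z by apply: sub_gen_smallest; left.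
  have [_ con] : subtree adj (Xi adj I J g F S).
    by apply: hull_subtree; exists z; left.
  exists z => //; apply: joined_sub (con _ _ Xu Xz) => a b.
  by apply: restrict_subset => t Xt; exists S.
have [_ conI] : subtree adj (skel_I adj I F).
  by apply: hull_subtree; case: I0 => i Ii; exists i; left.
move=> /toskel[u Iu xu] /toskel[v Iv yv]; apply: joined_trans xu _.
apply: (joined_trans (y := v)).
  apply: joined_sub (conI _ _ Iu Iv) => a b; apply: restrict_subset => t.
  exact: skel_I_canonical.
by apply: joined_sym yv; apply/restrict_sym/(adj_sym HT).
Qed.

(* Otherwise a vertex of B outside the canonical bi-tree C could be chosen to
   be a leaf, and by the last axiom of bi-trees it would come from I or J. *)
Lemma canonical_vert_image : C = M.
Proof.
have [phiI bb br alt [iE jE]] := pres.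
have CM : C `<=` M by move=> x [S _ /Xi_image].
apply/seteqP; split=> // _ [x0 _ <-].
pose N := [set x | C (phi x)].
have NC : phi @` N = C.
  by apply/seteqP; split=> [_ [x Nx <-]//|x Cx]; have [y _ yx] := CM _ Cx; exists y; rewrite /N /= ?yx.
suff NT : N = setT by have : N x0 by rewrite NT.
have [bs bi _ bcon bac] := black_blue_tree B.
have [i Ii] := I0.
have CI u : I u -> C u.
  by move=> Iu; apply: skel_I_canonical; apply: sub_gen_smallest; left.
apply: contrapT => NnT.
have [||x [nNx [y xy]]] := leaf_outside bs bi bac bcon _ _ NnT.
- by exists (imap B (SigSub (mem_set Ii))); rewrite /N /= iE; apply: CI.
- move=> u v Nu Nv; have := canonical_connected Nu Nv; rewrite -NC.
  move/(joined_pullback phiI); apply: joined_sub => s t.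
  by move=> /restrict_relP[st Ns Nt]; apply/restrict_relP; rewrite bb.
(* [x] has a single neighbour in the black-blue tree, and a vertex outside [C] is on no altered
   edge, so no red edge adds another. *)
have val1 : valence x = 1.
  rewrite -(card1 y); apply: eq_card => z; rewrite !inE col_some -xy bb br.
  have [->|alt1] := eqVneq (adj (phi x) (phi z)) (adj (g (phi x)) (g (phi z))).
    by rewrite orbb.
  by case: nNx; apply: altered_canonical alt1.
case: (bitree_leaf val1) => _ [[u _ ux]|[u _ ux]]; apply: nNx; rewrite /N /= -ux.
  by rewrite iE; apply: CI; apply: set_valP.
apply: skel_J_canonical; apply: sub_gen_smallest; left.
by rewrite jE; apply: set_valP.
Qed.

Lemma presents_canonical : canonical_bitree g B.
Proof.
have [phiI bb br alt [iE jE]] := pres.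
exists F; first exact/forest_perfect/presents_almost_automorphism.
exists phi; split=> //.
  rewrite -/C canonical_vert_image; split=> [x _|x y _ _ /phiI//|_ [x _ <-]].
    by exists x.
  by exists x.
have XiC x : exists2 S, F S & Xi adj I J g F S (phi x).
  by have : C (phi x); [rewrite canonical_vert_image; exists x | case=> S FS; exists S].
have [_ dF _ _] := forest_covering HT presents_almost_automorphism.
case=> x y /=.
- rewrite col_black bb br; split=> [[xy gxy]|[xy [S FS [Xx Xy]]]].
    (* A black edge lies in one tree [T] of the forest, so the trees [S] and [R] found for its ends
       coincide. *)
    split=> //; have [S FS Xx] := XiC x; have [R FR Xy] := XiC y.
    have jxy : joined (black adj g) (phi x) (phi y).
      by apply: joined_edge; rewrite /black /= xy.
    have [T FT [Tx Ty]] := (same_tree_forest HT g _ _).2 jxy.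
    exists S => //; split=> //; suff -> : S = R by [].
    have -> : S = T by apply: dF => //; exists (phi x); split=> //; apply: Xi_sub Xx.
    by apply: dF => //; exists (phi y); split=> //; apply: Xi_sub Xy.
  split=> //; rewrite -(joined_black HT gB) //; apply/(same_tree_forest HT).
  by exists S => //; split; [apply: Xi_sub Xx | apply: Xi_sub Xy].
- rewrite col_blue bb br; split; first by move/(blue_edge_forest HT _ _ gB).
  by move/(blue_edge_forest HT _ _ gB).
- rewrite col_red bb br; split; first by move/(red_edge_forest HT _ _ gB).
  by move/(red_edge_forest HT _ _ gB).
Qed.

End Presented.

Lemma canonical_equiv g (B B' : bitree adj I J) : bijective g ->
  canonical_bitree g B -> canonical_bitree g B' -> bitree_equiv B B'.
Proof.
move=> gB [F pF [phi [[pS pI pT] pE pi pj]]] [F' pF' [phi' [[qS qI qT] qE qi qj]]].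
have FF' := perfect_forest_unique HT pF' pF; subst F'.
have ex x : exists x', phi' x' = phi x by have [x' _ <-] := qT _ (pS x Logic.I); exists x'.
have ex' x' : exists x, phi x = phi' x' by have [x _ <-] := pT _ (qS x' Logic.I); exists x.
have [l lE] := choice ex; have [l' l'E] := choice ex'.
have inj x y : phi x = phi y -> x = y by apply: pI; rewrite inE.
have inj' x y : phi' x = phi' y -> x = y by apply: qI; rewrite inE.
exists l; split.
- by exists l' => x; [apply: inj; rewrite l'E lE | apply: inj'; rewrite lE l'E].
- move=> x y; have colE c : col (l x) (l y) = Some c <-> col x y = Some c.
    by rewrite pE qE !lE.
  case E: (col x y) => [c|]; first exact/colE.
  by case E': (col (l x) (l y)) => [c|] //; rewrite -E; apply/esym/colE.
- by move=> x; apply: inj'; rewrite lE pi qi.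
- by move=> y; apply: inj'; apply: (bij_inj gB); rewrite lE pj qj.
Qed.

Lemma equiv_canonical g (B B' : bitree adj I J) :
  canonical_bitree g B -> bitree_equiv B B' -> canonical_bitree g B'.
Proof.
move=> [F pF [phi [[pS pI pT] pE pi pj]]] [l [[l' lK l'K] lc li lj]].
exists F => //; exists (phi \o l'); split.
- split=> [x _|x y _ _ /= /pI|v /pT[x _ <-]]; first exact: pS.
    by rewrite !inE => /(_ Logic.I Logic.I)/(can_inj l'K).
  by exists (l x) => //=; rewrite lK.
- by move=> c x y; rewrite /= -pE -lc !l'K.
- by move=> x; rewrite /= li lK.
- by move=> y; rewrite /= lj lK.
Qed.

Lemma presents_equiv g (B B' : bitree adj I J) (phi : B' -> V) :
  presents g phi -> bitree_equiv B B' -> exists phi', @presents _ _ _ _ g B phi'.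
Proof.
move=> [pI bb br alt [iE jE]] [l [[l' lK l'K] lc li lj]].
exists (phi \o l); split.
- by move=> x y /pI/(can_inj lK).
- by move=> x y; rewrite /= -bb /black_blue /= lc.
- by move=> x y; rewrite /= -br /black_red /= lc.
- by move=> a b /alt[x <-]; exists (l' x); rewrite /= l'K.
- by split=> x /=; rewrite -?li -?lj.
Qed.

Lemma canonical_class g (B : bitree adj I J) : bijective g ->
  canonical_bitree g B -> canonical_bitree g = bitree_equiv B.
Proof.
move=> gB cB; apply/predeqP => B'; split; first exact: canonical_equiv.
exact: equiv_canonical.
Qed.

End Canonical.

(** * Realization of bi-trees and double cosets *)

(** Two embeddings of one finite graph provide the partial map from which back and forth starts; the
    last two hypotheses link it inside components. *)
Lemma partial_iso_graph (V1 V2 : choiceType) (e1 : rel V1) (e2 : rel V2)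
    (B : finType) (r : rel B) (f1 : B -> V1) (f2 : B -> V2) :
  injective f1 -> injective f2 ->
  (forall x y, e1 (f1 x) (f1 y) = r x y) ->
  (forall x y, e2 (f2 x) (f2 y) = r x y) ->
  (forall x y, joined e1 (f1 x) (f1 y) -> joined r x y) ->
  (forall x y, joined e2 (f2 x) (f2 y) -> joined r x y) ->
  partial_iso e1 e2 [seq (f1 x, f2 x) | x <- enum B].
Proof.
move=> I1 I2 E1 E2 J1 J2; set P := map _ _.
have inP x : (f1 x, f2 x) \in P by apply: map_f; rewrite mem_enum.
have link x y : joined r x y -> joined (pair_rel e1 P) (f1 x, f2 x) (f1 y, f2 y).
  apply: (joined_map (h := fun x => (f1 x, f2 x))) => a b ab.
  by rewrite /pair_rel /= E1 ab !inP.
split=> _ _ /mapP[x _ ->] /mapP[y _ ->] /=.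
- by rewrite !inj_eq.
- by rewrite E1 E2.
- by move/J1/link.
- by move/J2/link.
Qed.

Section Realization.
Variables (V : choiceType) (adj : rel V).
Hypothesis HT : regular_tree adj.

(** As [G] is finite, the forth half is enough. It starts from [P], the graph of the inverse of
    [im], and enumerates [G]. *)
Lemma embed_tree (G : finType) (e : rel G) (K : set V) (im : K -> G) :
  tree e -> finite_set K -> subtree adj K -> injective im ->
  (forall x y : K, adj (val x) (val y) -> e (im x) (im y)) ->
  exists phi : G -> V, [/\ injective phi,
    forall x y, e x y = adj (phi x) (phi y) &
    forall x, phi (im x) = val x].
Proof.
move=> [es ei _ econ eac] /finite_seqP[s sE] [[k0 Kk0] conK] imI im_edge.
pose P := [seq p <- [seq (b, v) | b <- enum G, v <- s] |
  `[<exists k : K, p = (im k, val k)>]].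
have PE p : p \in P <-> exists k : K, p = (im k, val k).
  rewrite mem_filter; split=> [/andP[/asboolP]//|[k ->]].
  apply/andP; split; first by apply/asboolP; exists k.
  apply/allpairsP; exists (im k, val k); split=> //=; first by rewrite mem_enum.
  by have := set_valP k; rewrite {1}sE.
pose r : rel (G * V) := [rel p q | [&& adj p.2 q.2, p \in P & q \in P]].
have conP p q : p \in P -> q \in P -> joined r p q.
  move=> /PE[k ->] /PE[k' ->].
  suff [k2 /val_inj <-//] : exists2 k2 : K, val k2 = val k' &
    joined r (im k, val k) (im k2, val k2).
  have := conK _ _ (set_valP k) (set_valP k').
  apply: (joined_ind (Q := fun v => exists2 k2 : K, val k2 = v &
    joined r (im k, val k) (im k2, val k2))); first by exists k => //; apply: joined_refl.
  move=> a b /restrict_relP[ab Ka Kb] [k2 k2a kk2].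
  exists (SigSub (mem_set Kb)) => //; apply: joined_trans kk2 (joined_edge _).
  apply/and3P; split; first by rewrite /= k2a.
    by apply/PE; exists k2.
  by apply/PE; exists (SigSub (mem_set Kb)).
(* [im] is only assumed to preserve edges. It also reflects them: the edges [e0] coming from [K]
   already connect its image, so by [joined_adjacent] every edge of [e] between image vertices is
   one of them. *)
pose e0 : rel G := [rel u v | `[<exists k k' : K,
  [/\ adj (val k) (val k'), u = im k & v = im k']>]].
have e0e : subrel e0 e by move=> u v /asboolP[k [k' [kk -> ->]]]; apply: im_edge.
have adjE (k k' : K) : e (im k) (im k') = adj (val k) (val k').
  apply/idP/idP => [ekk|]; last exact: im_edge.
  have : e0 (im k) (im k').
    apply: (joined_adjacent es eac e0e ei _ ekk).
    have inP (k2 : K) : (im k2, val k2) \in P by apply/PE; exists k2.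
    apply: (joined_map (h := fst)) (conP _ _ (inP k) (inP k')).
    move=> a b /and3P[ab /PE[k1 aE] /PE[k2 bE]]; apply/asboolP; exists k1, k2.
    by move: ab; rewrite aE bE.
  by case/asboolP=> [k1 [k2 [kk /imI -> /imI ->]]].
have link p q : p \in P -> q \in P -> joined (pair_rel e P) p q.
  move=> pP qP; apply: joined_sub (conP _ _ pP qP) => a b /and3P[ab aP bP].
  apply/and3P; split=> //; move: ab; have [k ->] := (PE _).1 aP.
  by have [k' ->] := (PE _).1 bP; rewrite /= adjE.
have isoP : partial_iso e adj P.
  split=> p q pP qP; try by move=> _; apply: link.
    have [k ->] := (PE _).1 pP; have [k' ->] := (PE _).1 qP.
    by rewrite /= (inj_eq imI) (inj_eq val_inj).
  have [k ->] := (PE _).1 pP; have [k' ->] := (PE _).1 qP.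
  exact: adjE.
have [||Q [PQ isoQ _] domQ] := extends_seq es ei eac (adj_sym HT) (adj_irr HT)
    (adj_acyclic HT) isoP (s := enum G).
- by move=> p y _ _; apply: adj_infinite.
- move=> x _; pose k : K := SigSub (mem_set Kk0).
  by exists (im k, val k); [apply/PE; exists k | apply: econ].
have ex x : exists v, (x, v) \in Q.
  by have /domQ/mapP[[x' v] xv /= ->] : x \in enum G; [rewrite mem_enum | exists v].
have [phi phiQ] := choice ex; have [Qinj Qadj _ _] := isoQ.
exists phi; split.
- move=> x y xy; apply/eqP.
  by rewrite (Qinj _ _ (phiQ x) (phiQ y)) /= xy.
- by move=> x y; rewrite -(Qadj _ _ (phiQ x) (phiQ y)).
- move=> k; have kQ : (im k, val k) \in Q by apply: PQ; apply/PE; exists k.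
  by apply/eqP; rewrite -(Qinj _ _ (phiQ (im k)) kQ) /=.
Qed.

(** * Removing from T finitely many edges between image vertices *)

Section Cut.
Variables (B : finType) (phi : B -> V) (r : rel B).
Hypotheses (phiI : injective phi) (rs : symmetric r).
Hypothesis con : forall x y, joined (restrict_rel adj (range phi)) (phi x) (phi y).

(** An edge is cut only if both its ends are image vertices not related by [r]. When [phi] embeds
    one tree of a bi-tree and [r] is the other tree, what remains between image vertices is
    black. *)
Definition cut : rel V := [rel a b | adj a b &&
  ~~ [exists x, exists y, [&& a == phi x, b == phi y & ~~ r x y]]].

Lemma cut_image x y : cut (phi x) (phi y) = adj (phi x) (phi y) && r x y.
Proof.
rewrite /cut /=; congr andb; apply/idP/idP => [|rxy].
  by apply: contraNT => nr; apply/existsP; exists x; apply/existsP; exists y; rewrite !eqxx.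
apply/existsP => -[x' /existsP[y' /and3P[/eqP/phiI xx /eqP/phiI yy]]].
by rewrite -xx -yy rxy.
Qed.

Lemma cut_sub : subrel cut adj.
Proof. by move=> a b /andP[]. Qed.

Lemma cut_out a b : adj a b -> ~~ cut a b -> range phi a /\ range phi b.
Proof.
rewrite /cut /= => ->; rewrite negbK.
case/existsP=> x /existsP[y /and3P[/eqP-> /eqP-> _]].
by split; [exists x | exists y].
Qed.

Lemma cut_sym : symmetric cut.
Proof.
have half a b : cut a b -> cut b a.
  move=> /andP[ab nex]; rewrite /cut /= (adj_sym HT) ab; apply: contra nex.
  case/existsP=> x /existsP[y /and3P[bx ay nr]].
  by apply/existsP; exists y; apply/existsP; exists x; rewrite bx ay rs nr.
by move=> a b; apply/idP/idP; apply: half.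
Qed.

Lemma cut_irr : irreflexive cut.
Proof. by move=> a; rewrite /cut /= (adj_irr HT). Qed.

Lemma cut_acyclic : acyclic cut.
Proof. exact: acyclic_sub cut_sub (adj_acyclic HT). Qed.

Lemma cut_infinite a : infinite_set [set b | cut a b].
Proof.
move=> fin; apply: (adj_infinite HT (x := a)).
apply: (@sub_finite_set _ _ ([set b | cut a b] `|` range phi)).
  move=> b ab; case: (boolP (cut a b)) => cab; [by left | right].
  by case: (cut_out ab cab).
by rewrite finite_setU; split=> //; apply: finite_image; apply: finite_finset.
Qed.

(** Where a path of T crosses a cut edge, it can be restarted at the far end, an image vertex. So
    every component of the cut forest meets the image, and back and forth from the image exhausts
    V. *)
Lemma cut_reach (x0 : B) v : exists x, joined cut (phi x) v.
Proof.
have := adj_joined HT (phi x0) v.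
apply: (joined_ind (Q := fun v => exists x, joined cut (phi x) v)).
  by exists x0; apply: joined_refl.
move=> a b ab [x xa]; case: (boolP (cut a b)) => cab.
  by exists x; apply: joined_trans xa (joined_edge cab).
by have [_ [y _ <-]] := cut_out ab cab; exists y; apply: joined_refl.
Qed.

(** The image is connected in T, hence convex, so a simple path of the cut forest between two of its
    vertices stays inside it. *)
Lemma cut_joined x y : joined cut (phi x) (phi y) ->
  joined [rel x y | adj (phi x) (phi y) && r x y] x y.
Proof.
move=> xy; have rx : range phi (phi x) by exists x.
have := subtree_convex (adj_sym HT) (adj_acyclic HT) cut_sub (con x y) xy rx.
move/(joined_pullback phiI); apply: joined_sub => u v /restrict_sub /=.
by rewrite cut_image.
Qed.

End Cut.

(** * From bi-trees to double cosets *)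

Section BiTree.
Variables (I J : set V).
Hypotheses (finI : finite_set I) (treeI : subtree adj I).
Hypotheses (finJ : finite_set J) (treeJ : subtree adj J).

(** [phi] embeds the black-blue tree and [psi] the black-red one. Cutting the blue edges from the
    first copy and the red edges from the second leaves two forests that agree on [B], and [f] is an
    isomorphism between them sending [phi x] to [psi x]. *)
Lemma bitree_realized (B : bitree adj I J) :
  exists g phi, bijective g /\ @presents _ adj I J g B phi.
Proof.
have [phi [phiI bb phii]] :=
  embed_tree (black_blue_tree B) finI treeI (@imap_inj _ _ _ _ B) (@imap_edge _ _ _ _ B).
have [psi [psiI br psij]] :=
  embed_tree (black_red_tree B) finJ treeJ (@jmap_inj _ _ _ _ B) (@jmap_edge _ _ _ _ B).
have [bs _ [x0 _] bcon _] := black_blue_tree B.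
have [rs _ _ rcon _] := black_red_tree B.
have con1 x y : joined (restrict_rel adj (range phi)) (phi x) (phi y).
  apply: joined_map (bcon x y) => a b ab.
  by apply/restrict_relP; split; [rewrite -bb | exists a | exists b].
have con2 x y : joined (restrict_rel adj (range psi)) (psi x) (psi y).
  apply: joined_map (rcon x y) => a b ab.
  by apply/restrict_relP; split; [rewrite -br | exists a | exists b].
pose e1 := cut phi (@black_red B); pose e2 := cut psi (@black_blue B).
pose r : rel B := [rel x y | black_blue x y && black_red x y].
have E1 x y : e1 (phi x) (phi y) = r x y by rewrite /e1 cut_image // -bb.
have E2 x y : e2 (psi x) (psi y) = r x y by rewrite /e2 cut_image // -br andbC.
have iso : partial_iso e1 e2 [seq (phi x, psi x) | x <- enum B].
  apply: (partial_iso_graph phiI psiI E1 E2) => x y.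
    by move/(cut_joined phiI con1); apply: joined_sub => u v; rewrite /= -bb.
  by move/(cut_joined psiI con2); apply: joined_sub => u v; rewrite /= -br andbC.
have memP x : (phi x, psi x) \in [seq (phi x, psi x) | x <- enum B].
  by apply: map_f; rewrite mem_enum.
have P0 : [seq (phi x, psi x) | x <- enum B] != [::].
  by apply/eqP => P0; have := memP x0; rewrite P0.
have [f [fbij fE fP]] := back_and_forth (cut_sym phi rs) (@cut_irr _ phi _)
  (@cut_acyclic _ phi _) (cut_sym psi bs) (@cut_irr _ psi _) (@cut_acyclic _ psi _)
  (vertices_countable HT) (vertices_countable HT) iso P0
  (fun a _ => @cut_infinite _ phi _ a) (fun a _ => @cut_infinite _ psi _ a).
set D1 := [set x | exists2 p, _ & _] in fbij fE.
set D2 := [set x | exists2 p, _ & joined (cut psi _) _ x] in fbij.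
have D1T : D1 = setT.
  apply/seteqP; split=> // v _; have [x xv] := cut_reach phi (@black_red B) x0 v.
  by exists (phi x, psi x).
have D2T : D2 = setT.
  apply/seteqP; split=> // v _; have [x xv] := cut_reach psi (@black_blue B) x0 v.
  by exists (phi x, psi x).
have fB : bijective f by rewrite -setTT_bijective -{1}D1T -D2T.
have fphi x : f (phi x) = psi x by have := fP _ (memP x).
have {}fE a b : e2 (f a) (f b) = e1 a b by apply: fE; rewrite D1T inE.
exists f, phi; split=> //; split=> //.
- by move=> x y; rewrite !fphi br.
(* An altered edge was cut in the source, or its image was cut in the target; otherwise [f] would
   preserve it. Either way its ends come from [B]. *)
- move=> a b; rewrite /altered /=; case: (boolP (adj a b)) => ab alt.
    have [|[x _ xa] _] := cut_out (r := @black_red B) (phi := phi) ab; last by exists x.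
    rewrite -/e1 -fE; apply: contra alt => /cut_sub fab.
    by rewrite fab.
  have fab : adj (f a) (f b) by case: (adj (f a) _) alt.
  have [|[x _ xa] _] := cut_out (r := @black_blue B) (phi := psi) fab.
    by rewrite -/e2 fE; apply: contra ab => /cut_sub.
  by exists x; apply: (bij_inj fB); rewrite fphi.
- by split=> // y; rewrite fphi psij.
Qed.

Lemma stabilizerP (K : set V) k : stabilizer adj K k <->
  [/\ bijective k, forall x y, adj (k x) (k y) = adj x y & forall x, K x -> k x = x].
Proof.
split=> [[[kB kE] kK]|[kB kE kK]].
  by split=> //; [rewrite -setTT_bijective | move=> x y; apply: kE; rewrite inE].
by split=> //; split; [rewrite setTT_bijective | move=> x y _ _; apply: kE].
Qed.

Lemma stabilizer_id (K : set V) : stabilizer adj K id.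
Proof. by apply/stabilizerP; split=> //; exists id. Qed.

Lemma stabilizer_comp (K : set V) k l :
  stabilizer adj K k -> stabilizer adj K l -> stabilizer adj K (k \o l).
Proof.
move=> /stabilizerP[kB kE kK] /stabilizerP[lB lE lK]; apply/stabilizerP; split.
- exact: bij_comp.
- by move=> x y; rewrite /= kE lE.
- by move=> x Kx; rewrite /= lK // kK.
Qed.

Lemma stabilizer_inv (K : set V) k h : stabilizer adj K k ->
  cancel k h -> cancel h k -> stabilizer adj K h.
Proof.
move=> /stabilizerP[kB kE kK] kh hk; apply/stabilizerP; split.
- by exists k.
- by move=> x y; rewrite -kE !hk.
- by move=> x Kx; rewrite -[in LHS](kK _ Kx) kh.
Qed.

Lemma double_coset_refl g : double_coset adj I J g g.
Proof. by exists id, id; split=> //; apply: stabilizer_id. Qed.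

Lemma double_coset_eq g g' : double_coset adj I J g g' ->
  double_coset adj I J g' = double_coset adj I J g.
Proof.
move=> [kJ [kI [HJ HI ->]]].
have /stabilizerP[[hJ kh hk] _ _] := HJ; have /stabilizerP[[hI kh' hk'] _ _] := HI.
apply/seteqP; split=> f [lJ [lI [KJ KI ->]]].
  exists (lJ \o kJ), (kI \o lI); split=> //; exact: stabilizer_comp.
exists (lJ \o hJ), (hI \o lI); split.
- by apply: stabilizer_comp => //; apply: stabilizer_inv HJ kh hk.
- by apply: stabilizer_comp => //; apply: stabilizer_inv HI kh' hk'.
- by apply/funext => x /=; rewrite kh hk'.
Qed.

(** Composing with [kJ] on the left changes no adjacency, and [kI] on the right is absorbed by
    moving the embedding by its inverse [h]. *)
Lemma presents_double_coset g g' (B : bitree adj I J) (phi : B -> V) :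
  double_coset adj I J g g' -> presents g phi ->
  exists phi', @presents _ adj I J g' B phi'.
Proof.
move=> [kJ [kI [/stabilizerP[bJ aJ fJ] /stabilizerP[[h hk kh] aI fI] ->]]].
move=> [phiI bb br alt [iE jE]]; exists (h \o phi).
have ah x y : adj (h x) (h y) = adj x y by rewrite -aI !kh.
split.
- exact: inj_comp (can_inj kh) phiI.
- by move=> x y; rewrite /= ah bb.
- by move=> x y; rewrite /= aJ !kh br.
- move=> a b; rewrite /altered /= aJ -aI => /alt[x xa].
  by exists x; rewrite /= xa hk.
- split=> x /=; first by rewrite iE -{1}(fI _ (set_valP x)) hk.
  by rewrite kh jE fJ //; apply: set_valP.
Qed.

(* An automorphism k of T with k \o phi' = phi exists by back and forth, and
   then g' \o k^-1 \o g^-1 is an automorphism too, as the edges altered by g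
   and g' correspond under k. *)
Lemma double_coset_presents g g' (B : bitree adj I J) (phi phi' : B -> V) :
  bijective g -> bijective g' -> presents g phi -> presents g' phi' ->
  double_coset adj I J g g'.
Proof.
move=> [h gK hK] g'B [phiI bb br alt [iE jE]] [phiI' bb' br' alt' [iE' jE']].
have [_ _ [x0 _] bcon _] := black_blue_tree B.
have iso : partial_iso adj adj [seq (phi' x, phi x) | x <- enum B].
  exact: (partial_iso_graph (r := @black_blue B)).
have memP x : (phi' x, phi x) \in [seq (phi' x, phi x) | x <- enum B].
  by apply: map_f; rewrite mem_enum.
have P0 : [seq (phi' x, phi x) | x <- enum B] != [::].
  by apply/eqP => P0; have := memP x0; rewrite P0.
have [k [kbij kE kP]] := back_and_forth (adj_sym HT) (adj_irr HT) (adj_acyclic HT)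
  (adj_sym HT) (adj_irr HT) (adj_acyclic HT)
  (vertices_countable HT) (vertices_countable HT) iso P0
  (fun a _ => adj_infinite HT (x := a)) (fun a _ => adj_infinite HT (x := a)).
set D1 := [set x | exists2 p, _ & joined adj p.1 x] in kbij kE.
set D2 := [set x | exists2 p, _ & joined adj p.2 x] in kbij.
have D1T : D1 = setT.
  by apply/seteqP; split=> // v _; exists (phi' x0, phi x0); last exact: adj_joined.
have D2T : D2 = setT.
  by apply/seteqP; split=> // v _; exists (phi' x0, phi x0); last exact: adj_joined.
have kB : bijective k by rewrite -setTT_bijective -{1}D1T -D2T.
have kphi x : k (phi' x) = phi x by have := kP _ (memP x).
have {}kE a b : adj (k a) (k b) = adj a b by apply: kE; rewrite D1T inE.
have kI := bij_inj kB; have [l kl lk] := kB.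
(* Between image vertices both sides are read from the colors of [B]; any other pair is altered
   neither by [g'] nor, once moved by [k], by [g]. *)
have core a b : adj (g' a) (g' b) = adj (g (k a)) (g (k b)).
  have [[[x xa] [y yb]]|nimg] := pselect ((exists x, phi' x = a) /\ exists y, phi' y = b).
    by rewrite -xa -yb !kphi -br -br'.
  have -> : adj (g' a) (g' b) = adj a b.
    apply/esym/eqP; apply: contrapT => /negP ab; apply: nimg; split.
      exact: alt' ab.
    by apply: (alt' b a); apply: altered_sym.
  rewrite -kE; apply/eqP; apply: contrapT => /negP ab; apply: nimg.
  have inv u v : altered adj g (k u, k v) -> exists x, phi' x = u.
    by move/alt => [x xu]; exists x; apply: kI; rewrite kphi.
  by split; [apply: inv ab | apply: (inv b a); apply: altered_sym].
exists (g' \o l \o h), k; split.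
- apply/stabilizerP; split.
  + apply: bij_comp; last by exists g.
    by apply: bij_comp => //; exists k.
  + by move=> x y; rewrite /= core !lk !hK.
  + move=> y Jy; pose j : J := SigSub (mem_set Jy).
    have {1}<- : g (phi (jmap B j)) = y by rewrite jE.
    by rewrite /= gK -kphi kl jE'.
- apply/stabilizerP; split=> // x Ix; pose i : I := SigSub (mem_set Ix).
  have {1}<- : phi' (imap B i) = x by rewrite iE'.
  by rewrite kphi iE.
- by apply/funext => x; rewrite /= gK kl.
Qed.

End BiTree.
End Realization.

Theorem proposition4p1 (V : choiceType) (adj : rel V)
    (HT : regular_tree adj) (I J : set V)
    (finI : finite_set I) (treeI : subtree adj I)
    (finJ : finite_set J) (treeJ : subtree adj J) :
  exists Phi : {D : set (V -> V) | double_cosets adj I J D} ->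
               {C : bitree adj I J -> Prop | bitree_class C},
    bijective Phi /\
    forall D (g : V -> V), spheromorphism adj g ->
      sval D = double_coset adj I J g -> sval (Phi D) = canonical_bitree g.
Proof.
have I0 := treeI.1.
have presented g : spheromorphism adj g -> bijective g /\
    exists (B : bitree adj I J) phi, @presents _ adj I J g B phi.
  move/(spheromorphism_almost_automorphism HT) => ag; split; first by case: ag.
  exact: presents_exists.
have canonE g (B : bitree adj I J) (phi : B -> V) : bijective g -> presents g phi ->
    canonical_bitree g = bitree_equiv B.
  move=> gB pres; apply: (canonical_class HT gB).
  exact: (presents_canonical HT I0 gB pres).
(* [Phi] uses a chosen representative [r D] of each double coset; [PhiE] shows that every other
   representative gives the same class. *)
have rep (D : {D : set (V -> V) | double_cosets adj I J D}) :
    exists g, spheromorphism adj g /\ double_coset adj I J g = sval D.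
  by case: D => D /= [g sg <-]; exists g.
have [r rP] := choice rep.
have cls D : bitree_class (@canonical_bitree V adj I J (r D)).
  have [gB [B [phi pres]]] := presented _ (rP D).1.
  by exists B; apply: canonE pres.
pose Phi D := exist (@bitree_class V adj I J) _ (cls D).
have PhiE D g : spheromorphism adj g -> sval D = double_coset adj I J g ->
    sval (Phi D) = canonical_bitree g.
  move=> sg DE /=; have [gB _] := presented _ sg.
  have [rB [B [phi pres]]] := presented _ (rP D).1.
  have rg : double_coset adj I J (r D) g.
    by rewrite (rP D).2 DE; apply: double_coset_refl.
  have [phi' pres'] := presents_double_coset rg pres.
  by rewrite (canonE _ _ _ rB pres) (canonE _ _ _ gB pres').
exists Phi; split=> //.
(* Equivalent bi-trees presenting [r D] and [r D'] can be replaced by a single one, to which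
   [double_coset_presents] applies. *)
have PhiI : injective Phi.
  move=> D D' /(congr1 sval) /= DD'.
  have [gB [B [phi pres]]] := presented _ (rP D).1.
  have [gB' [B' [phi' pres']]] := presented _ (rP D').1.
  have BB' : bitree_equiv B B'.
    rewrite -(canonE _ _ _ gB pres) DD'.
    exact: (presents_canonical HT I0 gB' pres').
  have [phi2 pres2] := presents_equiv pres' BB'.
  have rr := double_coset_presents HT gB gB' pres pres2.
  apply: eq_sig_hprop => [? ? ?|]; first exact: Prop_irrelevance.
  by rewrite -(rP D).2 -(rP D').2 (double_coset_eq rr).
have PhiS C : exists D, Phi D = C.
  case: C => C [B CB]; have [g [phi [gB pres]]] := bitree_realized HT finI treeI finJ treeJ B.
  (* The realizing bijection alters only edges between vertices of a finite image. *)
  have sg : spheromorphism adj g.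
    apply: (almost_automorphism_spheromorphism HT).
    exact: presents_almost_automorphism gB pres.
  have Dg : double_cosets adj I J (double_coset adj I J g) by exists g.
  exists (exist _ _ Dg); apply: eq_sig_hprop => [? ? ?|]; first exact: Prop_irrelevance.
  by rewrite (PhiE _ g) //= (canonE _ _ _ gB pres).
have [Psi PsiK] := choice PhiS.
by exists Psi => // D; apply: PhiI; rewrite PsiK.
Qed.
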